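(* Let $\mathcal{C}$ be a finite family, with $|\mathcal{C}|\ge4$, of compact convex sets in $\mathbb{R}^2$, all contained in the open unit disk, satisfying the $(4,3)$-property, and let $x\in A_1\cap A_2\cap A_3\cap A_4$. Let $f_0=(1,0)$, $f_1=f(x_1)$, $f_2=f(x_1+x_2)$, $f_3=f(x_1+x_2+x_3)$, let $c$ be the intersection point of $[f_0,f_2]$ and $[f_1,f_3]$, and for $1\le i\le 4$ let $\mathcal{C}_i=\{C\in\mathcal{C}: c\notin C,\ C\cap R^i_x=\emptyset\}$. Then $\tau(\mathcal{C}_i)\le 2$ for every $1\le i\le 4$.
   Context: The $(4,3)$-property: among every $4$ members some $3$ have a common point; $\tau$ is the piercing number (minimum number of points meeting every member). $f(t)=(\cos2\pi t,-\sin2\pi t)$; $[a,b]$ is a segment. $\Delta=\{x\in\mathbb{R}^4:x_i\ge0,\ \sum x_i=1\}$. For $x\in\Delta$, $R^i_x$ is the interior of the region bounded by the arc of the unit circle from $f(\sum_{j<i}x_j)$ to $f(\sum_{j\le i}x_j)$ (empty sum $=0$) and the segments $[(1,0),f(x_1+x_2)]$, $[f(x_1),f(x_1+x_2+x_3)]$ (the open piece of the disk cut by the two chords adjacent to the $i$-th arc; empty if $x_i=0$). $A_i$ is the set of $x\in\Delta$ for which there are $C_1,C_2,C_3\in\mathcal{C}$ with $C_1\cap C_2\cap C_3\neq\emptyset$ and $C_j\cap C_k\subset R^i_x$ for all $1\le j<k\le 3$. *)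

(* Defs.v *)
From HB Require Import structures.
From mathcomp Require Import all_boot all_order all_algebra.
From mathcomp Require Import finmap.
From mathcomp Require Import all_classical all_reals all_analysis.

Set Implicit Arguments.
Unset Strict Implicit.
Unset Printing Implicit Defensive.

Import Order.TTheory GRing.Theory Num.Theory.
Import numFieldNormedType.Exports.

Local Open Scope classical_set_scope.
Local Open Scope card_scope.
Local Open Scope ring_scope.

(* Members are counted as distinct sets.  The instance (p, q) = (4, 3) says
   that among any 4 members some 3 have a common point. *)
Definition pq_property (T : Type) (p q : nat) (F : set (set T)) : Prop :=
  forall G : set (set T), G `<=` F -> G #= `I_p ->
  exists H : set (set T),
    [/\ H `<=` G, H #= `I_q & \bigcap_(C in H) C !=set0].

Section Plane.
Variable R : realType.
Local Notation plane := (R * R)%type.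

Definition pierces (P : {fset plane}) (F : set (set plane)) : Prop :=
  forall C, F C -> exists2 p, p \in P & C p.

(* An infimum of natural numbers, hence attained; it is +oo exactly when no
   finite set of points meets every member. *)
Definition piercing_number (F : set (set plane)) : \bar R :=
  ereal_inf [set (#|` P|%fset)%:R%:E | P in [set P | pierces P F]].

Definition open_disk : set plane := [set p | p.1 ^+ 2 + p.2 ^+ 2 < 1].

Definition closed_disk : set plane := [set p | p.1 ^+ 2 + p.2 ^+ 2 <= 1].

Definition segment (a b : plane) : set plane :=
  [set (1 - t) *: a + t *: b | t in `[0, 1]].

Definition circle_point (t : R) : plane :=
  (cos (2 * pi * t), - sin (2 * pi * t)).

Definition simplex : set 'rV[R]_4 :=
  [set x | (forall i, 0 <= x 0 i) /\ \sum_i x 0 i = 1].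

(* Coordinates are numbered from 0: psum x k is the sum of the first k
   coordinates, and the i-th arc runs over the parameters from psum x i to
   psum x i.+1. *)
Definition psum (x : 'rV[R]_4) (k : nat) : R := \sum_(j < 4 | (j < k)%N) x 0 j.

Definition chord02 (x : 'rV[R]_4) : set plane :=
  segment (1, 0) (circle_point (psum x 2)).

Definition chord13 (x : 'rV[R]_4) : set plane :=
  segment (circle_point (psum x 1)) (circle_point (psum x 3)).

(* The open i-th arc is connected and avoids both chords, so the union below
   is the single piece of the closed disk cut along the chords that contains
   this arc; it is empty when x 0 i = 0. *)
Definition region (x : 'rV[R]_4) (i : 'I_4) : set plane :=
  interior (\bigcup_(t in `]psum x i, psum x i.+1[)
    connected_component (closed_disk `\` (chord02 x `|` chord13 x))
      (circle_point t)).

(* The three members are not required to be distinct. *)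
Definition triple_set (F : set (set plane)) (i : 'I_4) : set 'rV[R]_4 :=
  [set x | simplex x /\
    exists C1 C2 C3 : set plane,
      [/\ F C1, F C2 & F C3] /\
      C1 `&` C2 `&` C3 !=set0 /\
      [/\ C1 `&` C2 `<=` region x i, C1 `&` C3 `<=` region x i
        & C2 `&` C3 `<=` region x i]].

(* The chords meet in exactly one point as soon as all coordinates of x are
   positive, which holds when every region x i is nonempty. *)
Definition chord_crossing (x : 'rV[R]_4) : plane :=
  get (chord02 x `&` chord13 x).

Definition avoiding (F : set (set plane)) (x : 'rV[R]_4) (i : 'I_4) :
    set (set plane) :=
  [set C | [/\ F C, ~ C (chord_crossing x) & C `&` region x i = set0]].

End Plane.

(* Main.v *)
(* Let D_0, D_1, D_2 be the triple given by A_i and p a common point of it.  By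
   the (4,3)-property, two members C, C' missing R^i meet inside at least two
   of the D_j.  Outside R^i, distinct D_j are seen from p in disjoint sets of
   directions; the complement of R^i is a union of two half-planes, and each
   half-plane contributes one interval of directions to each D_j.  The convex
   set C `&` D_j lies in one of the half-planes unless D_j meets both at once,
   so C picks one interval for each j, and any two members pick the same one
   for at least two of the three indices.  Hence all members agree outside one
   index j_0.  Cutting directions between these intervals, every two members
   meet on one of two fixed lines through p, and a family of pairs of intervals
   on two lines which pairwise meet is pierced by two points.
   If two of the D_j coincide, that set lies in R^i and misses every C, so any
   three members meet and Helly's theorem gives one point. *)

Require Import Defs.
From HB Require Import structures.
From mathcomp Require Import all_boot all_order all_algebra.
From mathcomp Require Import finmap.
From mathcomp Require Import all_classical all_reals all_analysis.
From mathcomp Require Import ring lra zify.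

Import Order.TTheory GRing.Theory Num.Theory.
Import numFieldNormedType.Exports.

Local Open Scope classical_set_scope.
Local Open Scope card_scope.
Local Open Scope ring_scope.

(** * Intervals on one and two tracks *)

Lemma seq_argmin {I : eqType} {R : realDomainType} (f : I -> R) (s : seq I) i0 :
  i0 \in s -> exists2 i, i \in s & forall j, j \in s -> f i <= f j.
Proof.
elim: s i0 => // k s IHs i0 _; case: s IHs => [|l s] IHs.
  by exists k; rewrite ?mem_seq1 // => j; rewrite mem_seq1 => /eqP ->.
have [i si fi] := IHs l (mem_head _ _).
have [le_ki|lt_ik] := lerP (f k) (f i).
  exists k; rewrite ?mem_head // => j; rewrite in_cons => /orP[/eqP-> //|sj].
  exact: le_trans le_ki (fi j sj).
exists i; first by rewrite in_cons si orbT.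
by move=> j; rewrite in_cons => /orP[/eqP->|/fi//]; exact: ltW.
Qed.

(* An empty interval is encoded by [b i < a i]; it meets nothing. *)
Definition itv_meet {I : Type} {R : realDomainType} (a b : I -> R) (i j : I) :=
  [&& a i <= b i, a j <= b j, a i <= b j & a j <= b i].

Section Intervals.
Context {I : eqType} {R : realFieldType}.
Implicit Types (a b c d : I -> R) (s : seq I).

Lemma itv_meetC a b i j : itv_meet a b i j = itv_meet a b j i.
Proof. by rewrite /itv_meet; apply/and4P/and4P => -[]. Qed.

(** The least right end works: every interval begins before it, since it meets the interval that
    ends there. *)
Lemma itv_helly a b s :
  {in s &, forall i j, itv_meet a b i j} ->
  exists x, {in s, forall i, a i <= x <= b i}.
Proof.
case: s => [|i0 s] ab_s; first by exists 0.
have [i si bi] := seq_argmin b _ i0 (mem_head i0 s).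
exists (b i) => j sj; rewrite bi // andbT.
by have /and4P[] := ab_s _ _ sj si.
Qed.

(* If [i1] and [i2] do not meet, [j1] and [j2] both cover the gap between them. *)
Lemma itv_meet_bipartite a b i1 i2 j1 j2 :
  ~~ itv_meet a b i1 i2 ->
  itv_meet a b i1 j1 -> itv_meet a b i1 j2 ->
  itv_meet a b i2 j1 -> itv_meet a b i2 j2 -> itv_meet a b j1 j2.
Proof.
move=> + /and4P[? ? ? ?] /and4P[? ? ? ?] /and4P[? ? ? ?] /and4P[? ? ? ?].
rewrite /itv_meet !negb_and -!ltNge => /or4P[] ?; apply/and4P; split; lra.
Qed.

(* [x] is the least right end of an interval of the first track such that the
   intervals ending at or before [x] do not all meet on the second track. *)
Lemma two_track_piercing a b c d s :
  {in s &, forall i j, itv_meet a b i j || itv_meet c d i j} ->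
  exists x y, {in s, forall i, (a i <= x <= b i) || (c i <= y <= d i)}.
Proof.
move=> meet_s.
pose bad i j k := [&& a j <= b j, a k <= b k, b j <= b i, b k <= b i
  & ~~ itv_meet c d j k].
pose bads := [seq i <- s | has (fun j => has (bad i j) s) s].
have badsP i j k : i \in s -> j \in s -> k \in s -> bad i j k -> i \in bads.
  move=> si sj sk bijk; rewrite mem_filter si andbT.
  by apply/hasP; exists j => //; apply/hasP; exists k.
have empty1 i j : i \in s -> j \in s -> b i < a i -> itv_meet c d i j.
  move=> si sj lt_ba; have /orP[/and4P[]|//] := meet_s _ _ si sj.
  by rewrite leNgt lt_ba.
(* One-track Helly supplies [y] once the intervals missing [x] on the first track pairwise meet on
   the second. *)
suff [x [t meet_t xP]] : exists x, exists2 t : seq I,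
    {in t &, forall i j, itv_meet c d i j}
    & {in s, forall i, (a i <= x <= b i) || (i \in t)}.
  have [y yP] := itv_helly _ _ _ meet_t.
  by exists x, y => i /xP /orP[-> //|/yP ->]; rewrite orbT.
have [/eqP bads0|] := boolP (bads == [::]).
  exists 0, s => [i j si sj|i ->]; last by rewrite orbT.
  have [/empty1 -> //|ai] := ltP (b i) (a i).
  have [/(empty1 j i sj si)|aj] := ltP (b j) (a j); first by rewrite itv_meetC.
  apply/negPn/negP => Nmeet; have [le_ij|/ltW le_ji] := leP (b i) (b j).
    suff : j \in bads by rewrite bads0.
    by apply: (badsP j i j) => //; rewrite /bad ai aj le_ij lexx.
  suff : i \in bads by rewrite bads0.
  by apply: (badsP i i j) => //; rewrite /bad ai aj le_ji lexx.
move=> bads_n0; have [i0 i0P] : exists i0, i0 \in bads.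
  by case: (bads) bads_n0 => // k l _; exists k; exact: mem_head.
have [i + imin] := seq_argmin b _ _ i0P.
rewrite mem_filter => /andP[/hasP[u su /hasP[v sv]]].
move=> /and5P[au av bui bvi Nuv] si.
exists (b i), [seq j <- s | ~~ (a j <= b i <= b j)]; last first.
  by move=> j sj; rewrite mem_filter sj andbT orbN.
have right j k : j \in s -> k \in s -> b i < a j -> a k <= b k -> b k <= b i ->
    itv_meet c d k j.
  move=> sj sk ij ak ki; have /orP[/and4P[_ _ _ jk]|//] := meet_s _ _ sk sj.
  by move: (lt_le_trans ij (le_trans jk ki)); rewrite ltxx.
move=> j k; rewrite !mem_filter !negb_and -!ltNge => /andP[jx sj] /andP[kx sk].
have [/empty1 -> //|aj] := ltP (b j) (a j).
have [/(empty1 k j sk sj)|ak] := ltP (b k) (a k); first by rewrite itv_meetC.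
(* Two intervals right of [b i] both meet [u] and [v] on the second track, where [u] and [v] do not
   meet; for two on its left, minimality of [b i] applies. *)
case/orP: jx => jx; case/orP: kx => kx.
- by apply: (itv_meet_bipartite _ _ u v) => //; exact: right.
- by rewrite itv_meetC; apply: right => //; exact: ltW.
- by apply: right => //; exact: ltW.
- apply/negPn/negP => Nmeet; have [le_jk|/ltW le_kj] := leP (b j) (b k).
    suff /imin : k \in bads by rewrite leNgt kx.
    by apply: (badsP k j k) => //; rewrite /bad aj ak le_jk lexx.
  suff /imin : j \in bads by rewrite leNgt jx.
  by apply: (badsP j j k) => //; rewrite /bad aj ak le_kj lexx.
Qed.

End Intervals.

(** * Directions seen from a point *)

Section Plane.
Context {R : realType}.
Local Notation plane := (R * R)%type.
Implicit Types (C : set plane) (a b p z : plane).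

Lemma plane_eq a b : a.1 = b.1 -> a.2 = b.2 -> a = b.
Proof. by case: a b => [? ?] [? ?] /= -> ->. Qed.

Definition convex_in C := forall a b t,
  C a -> C b -> 0 <= t <= 1 -> C (a + t *: (b - a)).

Lemma convex_setP C : convex_set C -> convex_in C.
Proof.
move=> cvxC a b t Ca Cb /andP[t0 t1].
have := cvxC b a (Itv01 t0 t1); rewrite !inE => /(_ Cb Ca).
rewrite /conv /=; congr (C _); apply: plane_eq => /=;
  rewrite /GRing.scale /= /unstable.onem; ring.
Qed.

(** The parameters form a compact set, being closed inside the image of [C] under the projection
    [g]; by convexity its extremes bound an interval. A line missing [C] gets the empty interval
    [(1, 0)]. *)
Lemma line_itv C p e : compact C -> convex_in C -> e != 0 ->
  exists I : R * R, forall s, C (p + s *: e) <-> I.1 <= s <= I.2.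
Proof.
move=> cptC cvxC e0.
have [[s0 Cs0]|noC] := pselect (exists s, C (p + s *: e)); last first.
  exists (1, 0) => s; split=> [Cs|/= /andP[]]; first by case: noC; exists s.
  by move=> s1 s0; move: (le_trans s1 s0); rewrite ler10.
set S := [set s | C (p + s *: e)].
have n0 : 0 < e.1 ^+ 2 + e.2 ^+ 2.
  rewrite lt0r addr_ge0 ?sqr_ge0 // andbT paddr_eq0 ?sqr_ge0 // !sqrf_eq0.
  by apply: contra e0 => /andP[/eqP e1 /eqP e2]; apply/eqP/plane_eq.
pose g z : R := ((z.1 - p.1) * e.1 + (z.2 - p.2) * e.2) / (e.1 ^+ 2 + e.2 ^+ 2).
have gK s : g (p + s *: e) = s.
  by rewrite /g /= /GRing.scale /=; field; rewrite gt_eqF.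
have cg : continuous g.
  move=> z; apply: cvgMl; apply: cvgD; apply: cvgMl; apply: cvgB.
  - exact: cvg_fst. - exact: cvg_cst.
  - exact: cvg_snd. - exact: cvg_cst.
have cptS : compact S.
  apply: (@subclosed_compact _ _ (g @` C)).
  - have cl : closed C by apply: compact_closed.
    apply: (closed_comp _ cl) => s _.
    by apply: cvgD; [exact: cvg_cst|apply: cvgZl; exact: cvg_id].
  - by apply: continuous_compact => //; apply: continuous_subspaceT.
  - by move=> s Cs; exists (p + s *: e).
have S0 : S !=set0 by exists s0.
have cid_S : {within S, continuous (@id R)}.
  by apply: continuous_subspaceT => ?; exact: cvg_id.
have [M /set_mem SM leM] := compact_EVT_max S0 cptS cid_S.
have [m /set_mem Sm lem] := compact_EVT_min S0 cptS cid_S.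
exists (m, M) => s /=; split=> [Cs|/andP[ms sM]].
  by rewrite leM ?lem //; apply/mem_set.
have [eMm|neq] := eqVneq m M.
  by have -> : s = m by apply/eqP; rewrite eq_le ms eMm sM.
have mM : 0 < M - m by rewrite subr_gt0 lt_neqAle neq (le_trans ms sM).
have -> : p + s *: e = p + m *: e + ((s - m) / (M - m)) *:
    (p + M *: e - (p + m *: e)).
  by apply: plane_eq => /=; rewrite /GRing.scale /=; field;
    rewrite gt_eqF.
apply: cvxC => //; rewrite divr_ge0 ?subr_ge0 // ?(le_trans ms sM) //=.
by rewrite ler_pdivrMr // mul1r lerD2r.
Qed.

End Plane.

(** * Half-angle tangents as a coordinate on directions *)

Section Angle.
Context {R : realType}.
Local Notation plane := (R * R)%type.
Variables p w : plane.
Hypothesis w1 : w.1 ^+ 2 + w.2 ^+ 2 = 1.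
Implicit Types (a b z : plane) (m t : R).

(* Coordinates centred at [p] in which [w] is the direction [(-1, 0)]. *)
Let u z := - ((z.1 - p.1) * w.1 + (z.2 - p.2) * w.2).
Let v z := (z.2 - p.2) * w.1 - (z.1 - p.1) * w.2.
Let r z := Num.sqrt (u z ^+ 2 + v z ^+ 2).

Let r_ge0 z : 0 <= r z. Proof. exact: sqrtr_ge0. Qed.
Let r_sqr z : r z ^+ 2 = u z ^+ 2 + v z ^+ 2.
Proof. by rewrite sqr_sqrtr // addr_ge0 ?sqr_ge0. Qed.

(* The tangent of half the angle at [p] between [z] and [- w]. *)
Definition half_tan z := v z / (u z + r z).

(* [z] does not lie on the ray from [p] in direction [w]. *)
Definition off_ray z := 0 < u z + r z.

(** Rational parametrisation of the circle: in the coordinates [u], [v] this is [(1 - m^2, 2m)],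
    which is [1 + m^2] times the unit vector of half-angle tangent [m]. *)
Definition half_tan_dir m : plane :=
  (- ((1 - m ^+ 2) * w.1) - 2 * m * w.2, - ((1 - m ^+ 2) * w.2) + 2 * m * w.1).

Lemma half_tan_dir_neq0 m : half_tan_dir m != 0.
Proof.
apply/eqP => -[e1 e2].
have : (1 + m ^+ 2) ^+ 2 = 0.
  have -> : (1 + m ^+ 2) ^+ 2 = (w.1 ^+ 2 + w.2 ^+ 2) * (1 + m ^+ 2) ^+ 2.
    by rewrite w1 mul1r.
  have -> : (w.1 ^+ 2 + w.2 ^+ 2) * (1 + m ^+ 2) ^+ 2 =
    (- ((1 - m ^+ 2) * w.1) - 2 * m * w.2) ^+ 2 +
    (- ((1 - m ^+ 2) * w.2) + 2 * m * w.1) ^+ 2 by ring.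
  by rewrite e1 e2 expr0n addr0.
by move/eqP; rewrite sqrf_eq0 paddr_eq0 ?sqr_ge0 // oner_eq0.
Qed.

(** The distance [r z] to [p] is at least [|u z|], so [u z + r z <= 0] forces [r z = - u z] and
    [v z = 0]. *)
Lemma off_rayPn z : ~~ off_ray z -> exists2 t, 0 <= t & z = p + t *: w.
Proof.
rewrite /off_ray -leNgt => le0; exists (- u z).
  by rewrite oppr_ge0; have := r_ge0 z; lra.
have le_ur : `|u z| <= r z.
  by rewrite -sqrtr_sqr; apply: ler_wsqrtr; rewrite lerDl sqr_ge0.
have v0 : v z = 0.
  have ru : r z = - u z.
    by apply/eqP; rewrite eq_le; have := ler_norm (- u z); rewrite normrN; lra.
  by apply/eqP; rewrite -sqrf_eq0; have := r_sqr z; rewrite ru sqrrN => /eqP;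
    rewrite -subr_eq0 opprD addNKr oppr_eq0.
have e1 : z.1 - p.1 = (z.1 - p.1) * (w.1 ^+ 2 + w.2 ^+ 2) by rewrite w1 mulr1.
have e2 : z.2 - p.2 = (z.2 - p.2) * (w.1 ^+ 2 + w.2 ^+ 2) by rewrite w1 mulr1.
apply: plane_eq => /=; rewrite /GRing.scale /=.
  have -> : z.1 = p.1 + (- u z * w.1 - v z * w.2).
    by apply/eqP; rewrite [_ + (_ + _)]addrC -subr_eq {1}e1 /u /v; apply/eqP; ring.
  by rewrite v0 mul0r subr0.
have -> : z.2 = p.2 + (- u z * w.2 + v z * w.1).
  by apply/eqP; rewrite [_ + (_ + _)]addrC -subr_eq {1}e2 /u /v; apply/eqP; ring.
by rewrite v0 mul0r addr0.
Qed.

(** The factor [(u z + r z) / 2] turns the half-angle formulas back into [u z] and [v z], by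
    [r^2 = u^2 + v^2]. *)
Lemma half_tan_dirP z : off_ray z ->
  exists2 s, 0 < s & z = p + s *: half_tan_dir (half_tan z).
Proof.
rewrite /off_ray => gt0; exists ((u z + r z) / 2); first by rewrite divr_gt0.
have e1 : z.1 - p.1 = (z.1 - p.1) * (w.1 ^+ 2 + w.2 ^+ 2) by rewrite w1 mulr1.
have e2 : z.2 - p.2 = (z.2 - p.2) * (w.1 ^+ 2 + w.2 ^+ 2) by rewrite w1 mulr1.
have [eu ev] : (u z + r z) / 2 * (1 - half_tan z ^+ 2) = u z /\
    (u z + r z) / 2 * (2 * half_tan z) = v z.
  have : u z + r z != 0 by rewrite gt_eqF.
  have := r_sqr z; rewrite /half_tan.
  move: (u z) (v z) (r z) => U V S S2 n0; split; last by field.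
  have -> : (U + S) / 2 * (1 - (V / (U + S)) ^+ 2) =
      ((U + S) ^+ 2 - V ^+ 2) / (2 * (U + S)) by field.
  by rewrite sqrrD S2; field.
apply: plane_eq => /=; rewrite /GRing.scale /=.
  have -> : (u z + r z) / 2 * (- ((1 - half_tan z ^+ 2) * w.1) -
      2 * half_tan z * w.2) = - ((u z + r z) / 2 * (1 - half_tan z ^+ 2)) * w.1
      - ((u z + r z) / 2 * (2 * half_tan z)) * w.2 by ring.
  apply/eqP; rewrite addrC -subr_eq {1}e1 eu ev.
  by rewrite /u /v; apply/eqP; ring.
have -> : (u z + r z) / 2 * (- ((1 - half_tan z ^+ 2) * w.2) +
    2 * half_tan z * w.1) = - ((u z + r z) / 2 * (1 - half_tan z ^+ 2)) * w.2
    + ((u z + r z) / 2 * (2 * half_tan z)) * w.1 by ring.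
apply/eqP; rewrite addrC -subr_eq {1}e2 eu ev.
by rewrite /u /v; apply/eqP; ring.
Qed.

Lemma half_tan_continuous z : off_ray z -> {for z, continuous half_tan}.
Proof.
move=> oz.
have c1 : {for z, continuous (fun z : plane => z.1 - p.1)}.
  by apply: cvgB; [exact: cvg_fst|exact: cvg_cst].
have c2 : {for z, continuous (fun z : plane => z.2 - p.2)}.
  by apply: cvgB; [exact: cvg_snd|exact: cvg_cst].
have cu : {for z, continuous u} by apply: cvgN; apply: cvgD; apply: cvgMl.
have cv : {for z, continuous v} by apply: cvgB; apply: cvgMl.
have cr : {for z, continuous r}.
  apply: (@continuous_comp _ _ _ (fun z => u z ^+ 2 + v z ^+ 2) Num.sqrt).
    by apply: cvgD; rewrite expr2; apply: cvgM.
  exact: sqrt_continuous.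
apply: cvgM => //; apply: cvgV; first by rewrite gt_eqF.
exact: cvgD.
Qed.

Lemma half_tan_ivt a b m :
  (forall t, 0 <= t <= 1 -> off_ray (a + t *: (b - a))) ->
  half_tan a <= m <= half_tan b ->
  exists2 t, 0 <= t <= 1 & half_tan (a + t *: (b - a)) = m.
Proof.
move=> off /andP[am mb].
have [] := @IVT R (fun t => half_tan (a + t *: (b - a))) 0 1 m ler01.
- apply: continuous_in_subspaceT => t /set_mem /= t01.
  apply: (@continuous_comp _ _ _ (fun t : R => a + t *: (b - a)) half_tan).
    by apply: cvgD; [exact: cvg_cst|apply: cvgZl; exact: cvg_id].
  by apply: half_tan_continuous; apply: off; move: t01; rewrite in_itv.
- rewrite scale0r addr0 scale1r addrC subrK.
  by rewrite ge_min am /= le_max mb orbT.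
by move=> t; rewrite in_itv; exists t.
Qed.

End Angle.

(** * Cuts between blocks of directions *)

Section Cuts.
Context {R : realType}.
Implicit Types (A B : set R) (x y m : R).

Definition between x m y := (x <= m <= y) || (y <= m <= x).

Lemma betweenC x m y : between x m y = between y m x.
Proof. by rewrite /between orbC. Qed.

(** Comparing one pair of points settles the order: a reversed pair would force a point into both
    intervals. *)
Lemma disjoint_itv_lt A B : is_interval A -> is_interval B ->
  A `&` B = set0 -> A !=set0 -> B !=set0 ->
  (forall x y, A x -> B y -> x < y) \/ (forall x y, A x -> B y -> y < x).
Proof.
move=> itvA itvB AB0 [x0 Ax0] [y0 By0].
have noAB z : A z -> B z -> False.
  by move=> Az Bz; have : (A `&` B) z by []; rewrite AB0.
have lt_xy x y y' : A x -> B y -> B y' -> x < y -> x < y'.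
  move=> Ax By By' xy; rewrite ltNge; apply/negP => y'x.
  by apply: (noAB x) => //; apply: (itvB y' y) => //; rewrite y'x ltW.
have lt_yx x x' y : A x -> A x' -> B y -> x < y -> x' < y.
  move=> Ax Ax' By xy; rewrite ltNge; apply/negP => yx'.
  by apply: (noAB y) => //; apply: (itvA x x') => //; rewrite yx' ltW.
have [lt0|] := ltP x0 y0.
  by left=> x y Ax By; apply: (lt_yx x0) => //; exact: (lt_xy _ y0).
rewrite le_eqVlt => /orP[/eqP e|lt0]; first by case: (noAB y0); rewrite // e.
right=> x y Ax By; rewrite ltNge; apply/negP; rewrite le_eqVlt => /orP[/eqP e|xy].
  by apply: (noAB x) => //; rewrite e.
have := lt_yx _ _ _ Ax Ax0 (By) xy => /(lt_xy _ _ _ Ax0 By By0) /lt_trans.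
by move=> /(_ _ lt0); rewrite ltxx.
Qed.

Lemma itv_cut A B : is_interval A -> is_interval B -> A `&` B = set0 ->
  exists m, forall x y, A x -> B y -> between x m y.
Proof.
move=> itvA itvB AB0.
have [->|/set0P A0] := eqVneq A set0; first by exists 0.
have [->|/set0P B0] := eqVneq B set0; first by exists 0.
have [lt_AB|lt_BA] := disjoint_itv_lt _ _ itvA itvB AB0 A0 B0.
  exists (sup A) => x y Ax By; apply/orP; left; apply/andP; split.
    by apply: ub_le_sup => //; exists y => z Az; exact: ltW (lt_AB _ _ _ _).
  by apply: ge_sup => // z Az; exact: ltW (lt_AB _ _ _ _).
exists (sup B) => x y Ax By; apply/orP; right; apply/andP; split.
  by apply: ub_le_sup => //; exists x => z Bz; exact: ltW (lt_BA _ _ _ _).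
by apply: ge_sup => // z Bz; exact: ltW (lt_BA _ _ _ _).
Qed.

(* One cut [m] serves all [C i]: it is the right end of the leftmost of [A]
   and [B], so that [m] and one more cut separate [A], [B] and [C i]. *)
Lemma itv_common_cut I A B (C : I -> set R) :
  is_interval A -> is_interval B -> (forall i, is_interval (C i)) ->
  A `&` B = set0 -> (forall i, A `&` C i = set0) -> (forall i, B `&` C i = set0) ->
  exists m, (forall x y, A x -> B y -> between x m y) /\
  forall i, exists n, forall x y, (A `|` B) x -> C i y ->
    between x m y || between x n y.
Proof.
move=> itvA itvB itvC AB0 AC0 BC0.
have [A0|/set0P A0] := eqVneq A set0.
  exists 0; split=> [x y|i]; first by rewrite A0.
  have [n nP] := itv_cut _ _ itvB (itvC i) (BC0 i).
  by exists n => x y; rewrite A0 set0U => Bx Cy; rewrite nP ?orbT.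
have [B0|/set0P B0] := eqVneq B set0.
  exists 0; split=> [x y|i]; first by rewrite B0.
  have [n nP] := itv_cut _ _ itvA (itvC i) (AC0 i).
  by exists n => x y; rewrite B0 setU0 => Ax Cy; rewrite nP ?orbT.
wlog lt_AB : A B itvA itvB AB0 AC0 BC0 A0 B0 / forall x y, A x -> B y -> x < y.
  move=> IH; have [|lt_BA] := disjoint_itv_lt _ _ itvA itvB AB0 A0 B0.
    exact: IH.
  have [||m [mP nP]] := IH B A itvB itvA _ BC0 AC0 B0 A0.
  - by rewrite setIC.
  - by move=> x y Bx Ay; exact: lt_BA.
  - exists m; split=> [x y Ax By|i]; first by rewrite betweenC; exact: mP.
    by rewrite setUC.
have [b0 Bb0] := B0; have [a0 Aa0] := A0.
have le_m x : A x -> x <= sup A.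
  move=> Ax; apply: ub_le_sup => //.
  by exists b0 => z Az; exact: ltW (lt_AB _ _ _ _).
have ge_m y : B y -> sup A <= y.
  by move=> By; apply: ge_sup => // z Az; exact: ltW (lt_AB _ _ _ _).
exists (sup A); split=> [x y Ax By|i].
  by rewrite /between le_m // ge_m.
have [C0|/set0P C0] := eqVneq (C i) set0; first by exists 0 => x y; rewrite C0.
have [lt_AC|lt_CA] := disjoint_itv_lt _ _ itvA (itvC i) (AC0 i) A0 C0.
  have [n nP] := itv_cut _ _ itvB (itvC i) (BC0 i).
  exists n => x y [Ax|Bx] Cy; last by rewrite nP ?orbT.
  by rewrite /between le_m // ge_sup // => z Az; exact: ltW (lt_AC _ _ _ _).
(* A [C i] left of [A] is left of [sup A], which cuts it from [B]; the second cut handles [A]. *)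
have [n nP] := itv_cut _ _ itvA (itvC i) (AC0 i).
exists n => x y [Ax|Bx] Cy; first by rewrite nP ?orbT.
apply/orP; left; apply/orP; right; rewrite (ge_m _ Bx) andbT.
exact: le_trans (ltW (lt_CA _ _ Aa0 Cy)) (le_m _ Aa0).
Qed.

End Cuts.

(* The graph of the cube is bipartite, so three distinct sign vectors of length
   three are never pairwise at Hamming distance one. *)
Lemma sign_vectors_agree {T : eqType} (K : seq T) (f : 'I_3 -> T -> bool) :
  {in K &, forall C D, exists j k, [/\ j != k, f j C = f j D & f k C = f k D]} ->
  exists j0, forall j, j != j0 -> {in K &, forall C D, f j C = f j D}.
Proof.
move=> agree.
have [[j0 [C [D [KC KD NCD]]]]|noj] := pselect (exists j C D,
    [/\ C \in K, D \in K & f j C != f j D]); last first.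
  exists ord0 => j _ C D KC KD; apply/eqP/negPn/negP => NCD.
  by apply: noj; exists j, C, D.
have two C1 C2 j k : C1 \in K -> C2 \in K -> j != k -> f j C1 != f j C2 ->
    f k C1 = f k C2.
  move=> K1 K2 jk Nj; have [i [l [il fi fl]]] := agree _ _ K1 K2.
  have ij : i != j by apply: contraNneq Nj => <-; rewrite fi.
  have lj : l != j by apply: contraNneq Nj => <-; rewrite fl.
  have : (k == i) || (k == l).
    have [[[? ?] ?] ?] := (ltn_ord i, ltn_ord j, ltn_ord k, ltn_ord l).
    by move: jk il ij lj; rewrite -!val_eqE /=; lia.
  by case/orP => /eqP ->.
exists j0 => j jj0; suff agreeC E : E \in K -> f j C = f j E.
  by move=> E E' KE KE'; rewrite -!agreeC.
(* If [E] differed from [C] at [j], it would agree with [C] and differ from [D] at [j0]; then [C]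
   and [E] would both agree with [D] at [j]. *)
move=> KE; apply/eqP/negPn/negP => Nj.
have e0 := two _ _ _ _ KC KE jj0 Nj.
have Nj0 : f j0 E != f j0 D by rewrite -e0.
have j0j : j0 != j by rewrite eq_sym.
have eED := two _ _ _ _ KE KD j0j Nj0.
have eCD := two _ _ _ _ KC KD j0j NCD.
by move: Nj; rewrite eED eCD eqxx.
Qed.

(** * Piercing by two points *)

Section TwoPoints.
Context {R : realType}.
Local Notation plane := (R * R)%type.
(** Intended reading: [U] is the open disk, [reg] the region, [H true] and [H false] the half-planes
    covering its complement, [D] the triple through [p], [K] the members missing [reg]. Within [U],
    the ray from [p] along [w] stays in [reg]. *)
Variables (p w : plane) (U reg : set plane) (H : bool -> set plane).
Variables (D : 'I_3 -> set plane) (K : seq (set plane)).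

Hypothesis w1 : w.1 ^+ 2 + w.2 ^+ 2 = 1.
Hypothesis reg_ray : forall t, 0 <= t -> U (p + t *: w) -> reg (p + t *: w).
Hypothesis H_convex : forall b, convex_in (H b).
Hypothesis H_reg : forall b z, H b z -> ~ reg z.
Hypothesis H_cover : forall z, U z -> ~ reg z -> H true z \/ H false z.
Hypothesis H_connected : forall C, convex_in C -> C `<=` H true `|` H false ->
  [\/ C `<=` H true, C `<=` H false | exists2 z, C z & H true z /\ H false z].

Hypothesis Dp : forall j, D j p.
Hypothesis D_convex : forall j, convex_in (D j).
Hypothesis DU : forall j, D j `<=` U.
Hypothesis D_meet : forall j k, j != k -> D j `&` D k `<=` reg.

Hypothesis K_convex : forall C, C \in K -> convex_in C.
Hypothesis K_compact : forall C, C \in K -> compact C.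
Hypothesis KU : forall C, C \in K -> C `<=` U.
Hypothesis K_reg : forall C z, C \in K -> C z -> ~ reg z.
Hypothesis K_meet : forall C C', C \in K -> C' \in K -> exists j k,
  [/\ j != k, C `&` C' `&` D j !=set0 & C `&` C' `&` D k !=set0].

Let angle := half_tan p w.
Let out z := U z /\ ~ reg z.

Let out_off z : out z -> off_ray p w z.
Proof.
move=> [Uz Nz]; apply/negPn/negP => /(off_rayPn _ _ w1)[t t0 ez].
by apply: Nz; rewrite ez; apply: reg_ray; rewrite -?ez.
Qed.

Let out_K C z : C \in K -> C z -> out z.
Proof. by move=> KC Cz; split; [exact: KU KC _ Cz|exact: K_reg KC Cz]. Qed.

Let out_H j b z : D j z -> H b z -> out z.
Proof. by move=> Dz Hz; split; [exact: DU Dz|exact: H_reg Hz]. Qed.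

(* Of two points seen from [p] in the same direction, the nearer one lies in
   both [D j] and [D k], hence in [reg]. *)
Let angle_neq j k z z' : j != k -> D j z -> out z -> D k z' -> out z' ->
  angle z <> angle z'.
Proof.
wlog : j k z z' / exists s s', [/\ 0 < s, s <= s', z = p + s *: half_tan_dir w (angle z)
    & z' = p + s' *: half_tan_dir w (angle z')].
  move=> IH jk Dz oz Dz' oz' e.
  have [s s0 ez] := half_tan_dirP _ _ w1 _ (out_off _ oz).
  have [s' s'0 ez'] := half_tan_dirP _ _ w1 _ (out_off _ oz').
  have [ss'|/ltW s's] := leP s s'.
    by apply: (IH j k z z') => //; exists s, s'.
  by apply: (IH k j z' z) => //; [exists s', s|rewrite eq_sym].
move=> [s [s' [s0 ss' ez ez']]] jk Dz [_ Nz] Dz' _ e.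
have s'0 : 0 < s' by exact: lt_le_trans s0 ss'.
apply/Nz/(D_meet _ _ jk); split=> //.
have -> : z = p + (s / s') *: (z' - p).
  by rewrite {1}ez ez' e [p + _ - p]addrC addKr scalerA divfK ?gt_eqF.
apply: D_convex => //; rewrite ler_pdivrMr // mul1r ss' andbT.
by rewrite divr_ge0 // ltW.
Qed.

Let angle_ivt C a b m : convex_in C -> C `<=` out -> C a -> C b ->
  angle a <= m <= angle b -> exists2 z, C z & angle z = m.
Proof.
move=> cvxC outC Ca Cb /(half_tan_ivt _ _)[t t01|t t01 <-].
  by apply/out_off/outC/cvxC.
by exists (a + t *: (b - a)) => //; exact: cvxC.
Qed.

Let merged j := exists z, [/\ D j z, H true z & H false z].

(* The directions in which [D j] is seen inside [H b]; when [D j] meets both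
   pieces of the complement of [reg] in one point, there is a single block. *)
Let block j b : set R := [set m | exists z b',
  [/\ D j z, H b' z, angle z = m & merged j \/ b' = b]].

(** The part of [D j] in one piece is convex, so its angles take all intermediate values. Points in
    different pieces share a block only when [D j] is merged, and are then linked through a point of
    both pieces. *)
Let block_itv j b : is_interval (block j b).
Proof.
have same x m y b' z z' : D j z -> H b' z -> angle z = x -> D j z' -> H b' z' ->
    angle z' = y -> x <= m <= y -> merged j \/ b' = b -> block j b m.
  move=> Dz Hz ez Dz' Hz' ez' xmy mb.
  have [|||||q [Dq Hq] eq] := angle_ivt (D j `&` H b') z z' m.
  - move=> a c t [Da Ha] [Dc Hc] t01.
    by split; [exact: D_convex|exact: H_convex].
  - by move=> q [Dq Hq]; exact: out_H Dq Hq.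
  - by [].
  - by [].
  - by rewrite ez ez'.
  - by exists q, b'.
move=> x y [z [b1 [Dz Hz ez mb1]]] [z' [b2 [Dz' Hz' ez' mb2]]] m xmy.
have [e12|] := eqVneq b1 b2.
  by apply: (same x m y b1 z z') => //; rewrite e12.
move=> /eqP N12; have mj : merged j.
  by case: mb1 => // e1; case: mb2 => // e2; case: N12; rewrite e1 e2.
have [q [Dq Hq1 Hq2]] := mj.
have Hq c : H c q by case: c.
have /andP[xm my] := xmy; have [mq|/ltW qm] := leP m (angle q).
  by apply: (same x m (angle q) b1 z q) => //; rewrite xm mq.
by apply: (same (angle q) m y b2 q z') => //; rewrite qm my.
Qed.

Let block_disj j k b c : j != k -> block j b `&` block k c = set0.
Proof.
move=> jk; apply/seteqP; split=> // m [[z [b1 [Dz Hz ez _]]]].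
move=> [z' [b2 [Dz' Hz' ez' _]]].
apply: (angle_neq _ _ z z' jk) => //.
- exact: out_H Dz Hz.
- exact: out_H Dz' Hz'.
- by rewrite ez ez'.
Qed.

(** Selects the block of [D j] that [C] uses. For a merged [D j] the two blocks coincide, and the
    constant value [true] makes all members agree. *)
Let side j C := `[< merged j \/ C `&` D j `<=` H true >].

Let CD_side j C : C \in K -> ~ merged j ->
  C `&` D j `<=` H true \/ C `&` D j `<=` H false.
Proof.
move=> KC Nm; have [||sub|sub|[z [Cz Dz] [H1 H2]]] := H_connected (C `&` D j).
- move=> a c t [Ca Da] [Cc Dc] t01.
  by split; [exact: K_convex|exact: D_convex].
- by move=> z [Cz Dz]; have [Uz Nz] := out_K _ _ KC Cz; exact: H_cover.
- by left.
- by right.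
- by case: Nm; exists z.
Qed.

Let block_side j C z : C \in K -> C z -> D j z -> block j (side j C) (angle z).
Proof.
move=> KC Cz Dz; have [Uz Nz] := out_K _ _ KC Cz.
have [mj|Nm] := pselect (merged j).
  by case: (H_cover _ Uz Nz) => Hz; [exists z, true|exists z, false]; split=> //;
    left.
have [sub|Nsub] := pselect (C `&` D j `<=` H true).
  exists z, true; split=> //; first exact: sub.
  by right; apply/esym/asboolP; right.
case: (CD_side _ _ KC Nm) => // sub; exists z, false; split=> //.
  exact: sub.
by right; apply/esym/asboolPn => -[].
Qed.

(** Unless [D j] is merged, [C] and [C'] each stay in one piece within [D j], and a common point
    there makes it the same piece. *)
Let side_eq j C C' : C \in K -> C' \in K -> C `&` C' `&` D j !=set0 ->
  side j C = side j C'.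
Proof.
move=> KC KC' [z [[Cz C'z] Dz]].
suff half E E' : E \in K -> E' \in K -> E z -> E' z -> side j E -> side j E'.
  by apply/idP/idP; exact: half.
move=> KE KE' Ez E'z /asboolP sE; apply/asboolP.
have [mj|Nm] := pselect (merged j); first by left.
case: sE => // sub; right.
case: (CD_side _ _ KE' Nm) => // sub'; case: Nm; exists z.
by split=> //; [exact: sub|exact: sub'].
Qed.

Let pt m s : plane := p + s *: half_tan_dir w m.

Let line_itvs : exists lo hi : R -> set plane -> R,
  forall m C, C \in K -> forall s, C (pt m s) <-> lo m C <= s <= hi m C.
Proof.
have : forall mC : R * set plane, exists I : R * R, mC.2 \in K ->
    forall s, mC.2 (pt mC.1 s) <-> I.1 <= s <= I.2.
  move=> [m C] /=; have [KC|] := boolP (C \in K); last by exists (0, 0).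
  have [I IP] := line_itv C p _ (K_compact _ KC) (K_convex _ KC)
    (half_tan_dir_neq0 _ w1 m).
  by exists I => _.
move=> /choice[f fP]; exists (fun m C => (f (m, C)).1), (fun m C => (f (m, C)).2).
by move=> m C KC; exact: (fP (m, C)).
Qed.

Lemma two_points_pierce : exists x y, forall C, C \in K -> C x \/ C y.
Proof.
have [lo [hi itvP]] := line_itvs.
pose meet m C C' := itv_meet (lo m) (hi m) C C'.
(* The segment between two common points with angles on either side of [m] crosses the line of
   direction [m], again at a point of both sets. *)
have meet_cross m C C' a b : C \in K -> C' \in K -> (C `&` C') a ->
    (C `&` C') b -> between (angle a) m (angle b) -> meet m C C'.
  move=> KC KC'; wlog ab : a b / angle a <= m <= angle b.
    move=> IH ICa ICb /orP[?|?]; first by apply: (IH a b) => //; apply/orP; left.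
    by apply: (IH b a) => //; apply/orP; left.
  move=> Ca Cb _; have [|||||z [Cz C'z] ez] := angle_ivt (C `&` C') a b m => //.
  - move=> c d t [? ?] [? ?] ?.
    by split; [exact: K_convex|exact: K_convex].
  - by move=> z [Cz _]; exact: out_K KC Cz.
  have [s _ es] := half_tan_dirP _ _ w1 _ (out_off _ (out_K _ _ KC Cz)).
  have es' : z = pt m s by rewrite /pt -ez.
  have /andP[l1 h1] : lo m C <= s <= hi m C by apply/itvP => //; rewrite -es'.
  have /andP[l2 h2] : lo m C' <= s <= hi m C' by apply/itvP => //; rewrite -es'.
  by apply/and4P; split; [apply: le_trans h1|apply: le_trans h2|
    apply: le_trans h2|apply: le_trans h1].
have [/eqP->|[C0 KC0]] : K == [::] \/ exists C, C \in K.
  by case: (K) => [|C s]; [left|right; exists C; rewrite mem_head].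
  by exists p, p.
have [j0 side0] : exists j0, forall j, j != j0 ->
    {in K &, forall C C', side j C = side j C'}.
  apply: sign_vectors_agree => C C' KC KC'.
  have [j [k [jk Ij Ik]]] := K_meet _ _ KC KC'.
  by exists j, k; split=> //; exact: side_eq.
have [j1 [j2 [j10 j20 j12 jE]]] : exists j1 j2, [/\ j1 != j0, j2 != j0, j1 != j2
    & forall j, [|| j == j0, j == j1 | j == j2]].
  exists (ordS j0), (ordS (ordS j0)).
  by case: j0 {side0} => [[|[|[|//]]] i0]; split=> //; case=> [[|[|[|//]]] ?].
(* The blocks used at [j1] and [j2] are the same for all members; only the one at [j0] varies, hence
   one common [m] and a second cut for each sign. *)
have [m [mP nP]] := itv_common_cut _ (block j1 (side j1 C0))
  (block j2 (side j2 C0)) (block j0) (block_itv _ _) (block_itv _ _)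
  (block_itv _) (block_disj _ _ _ _ j12) (fun b => block_disj _ _ _ _ j10)
  (fun b => block_disj _ _ _ _ j20).
have [n {}nP] := choice nP.
have blockC j C z : C \in K -> C z -> D j z -> j != j0 ->
    block j (side j C0) (angle z).
  by move=> KC Cz Dz jj0; rewrite (side0 _ jj0 _ C) //; exact: block_side.
have meet12 C C' : C \in K -> C' \in K -> C `&` C' `&` D j1 !=set0 ->
    C `&` C' `&` D j2 !=set0 -> meet m C C'.
  move=> KC KC' [a [[Ca C'a] Da]] [b [[Cb C'b] Db]].
  apply: (meet_cross _ _ _ a b) => //; apply: mP.
    exact: (blockC _ C).
  exact: (blockC _ C).
have meet0 j C C' : j != j0 -> C \in K -> C' \in K -> C `&` C' `&` D j !=set0 ->
    C `&` C' `&` D j0 !=set0 -> meet m C C' || meet (n (side j0 C)) C C'.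
  move=> jj0 KC KC' [a [[Ca C'a] Da]] [b [[Cb C'b] Db]].
  have /orP[ab|ab] : between (angle a) m (angle b) ||
      between (angle a) (n (side j0 C)) (angle b).
  - apply: nP; last exact: block_side.
    have := jE j; rewrite (negPf jj0) /= => /orP[/eqP e|/eqP e].
      by left; rewrite -e; exact: (blockC _ C).
    by right; rewrite -e; exact: (blockC _ C).
  - by rewrite (meet_cross m C C' a b).
  - by rewrite (meet_cross (n _) C C' a b) ?orbT.
(* If the two indices where [C] and [C'] meet avoid [j0], then [m] separates their blocks. Otherwise
   [m] or the second cut does, and the common point in [D j0] equates the signs. *)
have meet_mn C C' : C \in K -> C' \in K -> meet m C C' \/
    side j0 C = side j0 C' /\ meet (n (side j0 C)) C C'.
  move=> KC KC'; have [j [k [jk Ij Ik]]] := K_meet _ _ KC KC'.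
  have [ej|jj0] := eqVneq j j0.
    have kj0 : k != j0 by rewrite -ej eq_sym.
    rewrite ej in Ij; have /orP[|] := meet0 k C C' kj0 KC KC' Ik Ij; first by left.
    by right; split=> //; exact: side_eq.
  have [ek|kj0] := eqVneq k j0.
    rewrite ek in Ik; have /orP[|] := meet0 j C C' jj0 KC KC' Ij Ik; first by left.
    by right; split=> //; exact: side_eq.
  left; have := (jE j, jE k); rewrite (negPf jj0) (negPf kj0) /=.
  move=> -[/orP[]/eqP ej /orP[]/eqP ek]; rewrite ej ek in jk Ij Ik.
  - by rewrite eqxx in jk.
  - exact: meet12.
  - exact: meet12.
  - by rewrite eqxx in jk.
suff [n' meet_n'] : exists n', {in K &, forall C C', meet m C C' || meet n' C C'}.
  have [x [y xyP]] := two_track_piercing _ _ _ _ _ meet_n'.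
  exists (pt m x), (pt n' y) => C KC.
  by have /orP[?|?] := xyP _ KC; [left|right]; apply/itvP.
(* If the members of sign [true] pairwise meet on [m], only sign [false] requires a second line. *)
have [meet_true|Ntrue] := pselect (forall C C', C \in K -> C' \in K ->
    side j0 C -> side j0 C' -> meet m C C').
  exists (n false) => C C' KC KC'; have [->//|[e nCC']] := meet_mn _ _ KC KC'.
  have [sC|/negbTE sC] := boolP (side j0 C).
    by rewrite meet_true // -e.
  by rewrite -sC nCC' orbT.
exists (n true) => C C' KC KC'; have [->//|[e nCC']] := meet_mn _ _ KC KC'.
have [sC|/negbTE sC] := boolP (side j0 C); first by rewrite -sC nCC' orbT.
(* Members of opposite signs meet on [m]. When [E] and [E'] of sign [true] do not, any two of sign
   [false] cover the gap between them, so they meet. *)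
apply/orP; left; apply: contrapT => NCC'; apply: Ntrue => E E' KE KE' sE sE'.
apply/negPn/negP => NEE'; apply: NCC'.
have cross F G : F \in K -> G \in K -> side j0 F -> side j0 G = false ->
    meet m F G.
  by move=> KF KG sF sG; have [//|[]] := meet_mn _ _ KF KG; rewrite sF sG.
by apply: (itv_meet_bipartite _ _ E E') => //; apply: cross; rewrite -?e.
Qed.

End TwoPoints.

(** * Helly's theorem in the plane *)

Section Helly.
Context {R : realType}.
Local Notation plane := (R * R)%type.
Implicit Types (A B C : set plane).

Lemma convex_combination C {I : eqType} (s : seq I) (c : I -> R) (p : I -> plane) :
  convex_in C -> {in s, forall i, 0 < c i} -> {in s, forall i, C (p i)} ->
  s != [::] -> C ((\sum_(i <- s) c i)^-1 *: \sum_(i <- s) c i *: p i).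
Proof.
move=> cvxC; elim: s => // i s IHs c0 Cp _; rewrite !big_cons.
have ci0 : 0 < c i by apply: c0; rewrite mem_head.
have Cpi : C (p i) by apply: Cp; rewrite mem_head.
have {}c0 : {in s, forall i, 0 < c i}.
  by move=> j sj; apply: c0; rewrite in_cons sj orbT.
have {}Cp : {in s, forall i, C (p i)}.
  by move=> j sj; apply: Cp; rewrite in_cons sj orbT.
have [->|s0] := eqVneq s [::].
  by rewrite !big_nil !addr0 scalerK // gt_eqF.
have S0 : 0 < \sum_(j <- s) c j.
  case: s s0 c0 {Cp IHs} => // j s _ c0; rewrite big_cons ltr_pwDl ?c0 ?mem_head //.
  by rewrite big_seq sumr_ge0 // => k sk; rewrite ltW // c0 // in_cons sk orbT.
have := cvxC _ _ ((\sum_(j <- s) c j) / (c i + \sum_(j <- s) c j)) Cpi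
  (IHs c0 Cp s0).
move: S0; set S := \sum_(j <- s) c j; set P := \sum_(j <- s) _ => S0.
have cS0 : 0 < c i + S by rewrite addr_gt0.
have -> : p i + S / (c i + S) *: (S^-1 *: P - p i) =
    (c i + S)^-1 *: (c i *: p i + P).
  apply: plane_eq => /=; rewrite /GRing.scale /=; field; by rewrite !gt_eqF.
apply; rewrite divr_ge0 ?(ltW S0) ?(ltW cS0) //=.
by rewrite ler_pdivrMr // mul1r lerDr ltW.
Qed.

(** Four rows [(p.1, p.2, 1)] in dimension three are linearly dependent; the column of ones makes
    the coefficients sum to zero. *)
Lemma affine_dependence (p : 'I_4 -> plane) : exists l : 'I_4 -> R,
  [/\ exists i, l i != 0, \sum_i l i = 0 & \sum_i l i *: p i = 0].
Proof.
pose M : 'M[R]_(4, 3) := \matrix_(i, j) nth 0 [:: (p i).1; (p i).2; 1] j.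
have : kermx M != 0.
  by rewrite -mxrank_eq0 mxrank_ker -lt0n subn_gt0 (leq_ltn_trans (rank_leq_col _)).
move=> /rowV0Pn[v /sub_kermxP vM v0].
have sum0 j : \sum_i v 0 i * nth 0 [:: (p i).1; (p i).2; 1] (j : 'I_3) = 0.
  by have /matrixP/(_ 0 j) := vM; rewrite !mxE; under eq_bigr do rewrite mxE.
exists (v 0); split.
- by have /rV0Pn := v0.
- by rewrite -[RHS](sum0 (Ordinal (isT : 2 < 3)%N)); apply: eq_bigr => i _; rewrite /= mulr1.
- apply: plane_eq => /=.
    rewrite (raddf_sum fst) -[RHS](sum0 (Ordinal (isT : 0 < 3)%N)).
    exact: eq_bigr.
  rewrite (raddf_sum snd) -[RHS](sum0 (Ordinal (isT : 1 < 3)%N)).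
  exact: eq_bigr.
Qed.

(** Radon's argument: the positive and negative parts of an affine dependence have the same
    barycentre. For each [k], one part omits [k], so all its points lie in [C k]. *)
Lemma radon_helly (C : 'I_4 -> set plane) (p : 'I_4 -> plane) :
  (forall k, convex_in (C k)) -> (forall i k, i != k -> C k (p i)) ->
  exists z, forall k, C k z.
Proof.
move=> cvxC Cp; have [l [[i0 li0] suml sumlp]] := affine_dependence p.
pose P := [seq i <- index_enum 'I_4 | 0 < l i].
pose N := [seq i <- index_enum 'I_4 | l i < 0].
have split_sum (V : zmodType) (F : 'I_4 -> V) : (forall i, l i = 0 -> F i = 0) ->
    \sum_i F i = 0 -> \sum_(i <- P) F i = \sum_(i <- N) - F i.
  move=> F0 sumF; rewrite !big_filter sumrN; apply/eqP; rewrite -addr_eq0.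
  apply/eqP; rewrite -[RHS]sumF [RHS](bigID (fun i => 0 < l i)) /=; congr (_ + _); apply/esym.
  rewrite (bigID (fun i => l i < 0)) /= [X in _ + X]big1 ?addr0.
    by apply: eq_bigl => i; case: (ltgtP (l i) 0).
  by move=> i; case: (ltgtP (l i) 0) => // e _; exact: F0.
have sumPN : \sum_(i <- P) l i = \sum_(i <- N) - l i by exact: split_sum.
have sumPNp : \sum_(i <- P) l i *: p i = \sum_(i <- N) - l i *: p i.
  rewrite (split_sum _ (fun i => l i *: p i)) => [|i ->|//].
    by apply: eq_bigr => i _; rewrite scaleNr.
  by rewrite scale0r.
have PN0 : P != [::] /\ N != [::].
  have pos i : i \in P -> 0 < l i by rewrite mem_filter => /andP[].
  have neg i : i \in N -> 0 < - l i by rewrite mem_filter oppr_gt0 => /andP[].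
  have nil_sum (s : seq 'I_4) (c : 'I_4 -> R) : (forall i, i \in s -> 0 < c i) ->
      \sum_(i <- s) c i = 0 -> s = [::].
    case: s => // i s c0; rewrite big_cons => /eqP; rewrite gt_eqF //.
    rewrite ltr_pwDl ?c0 ?mem_head // big_seq sumr_ge0 // => j sj.
    by rewrite ltW // c0 // in_cons sj orbT.
  have PN : P = [::] <-> N = [::].
    split=> e.
      by apply: nil_sum neg _; rewrite -sumPN e big_nil.
    by apply: nil_sum pos _; rewrite sumPN e big_nil.
  have : ~ (P = [::] /\ N = [::]).
    move=> [P0 N0]; have : (i0 \in P) || (i0 \in N).
      by rewrite !mem_filter !mem_index_enum !andbT orbC -neq_lt.
    by rewrite P0 N0.
  by move=> NPN; split; apply/eqP => e; apply: NPN; split=> //; exact/PN.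
pose z := (\sum_(i <- P) l i)^-1 *: \sum_(i <- P) l i *: p i.
exists z => k; have [lk|lk] := ltP 0 (l k).
  rewrite /z sumPN sumPNp; apply: convex_combination => //.
  - by move=> i; rewrite mem_filter oppr_gt0 => /andP[].
  - move=> i; rewrite mem_filter => /andP[li _]; apply: Cp.
    by apply: contraTneq li => ->; rewrite -leNgt ltW.
  - by case: PN0.
apply: convex_combination => //.
- by move=> i; rewrite mem_filter => /andP[].
- move=> i; rewrite mem_filter => /andP[li _]; apply: Cp.
  by apply: contraTneq li => ->; rewrite -leNgt.
- by case: PN0.
Qed.

Lemma helly4 A B C D :
  convex_in A -> convex_in B -> convex_in C -> convex_in D ->
  B `&` C `&` D !=set0 -> A `&` C `&` D !=set0 -> A `&` B `&` D !=set0 ->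
  A `&` B `&` C !=set0 -> A `&` B `&` C `&` D !=set0.
Proof.
move=> cA cB cC cD [a [[Ba Ca] Da]] [b [[Ab Cb] Db]] [c [[Ac Bc] Dc]].
move=> [d [[Ad Bd] Cd]].
have [||z zP] := radon_helly (nth set0 [:: A; B; C; D]) (nth 0 [:: a; b; c; d]).
- by case=> [[|[|[|[|//]]]] ?].
- by case=> [[|[|[|[|//]]]] ?] [[|[|[|[|//]]]] ?].
exists z; split; first split; first split.
- exact: (zP (Ordinal (isT : 0 < 4)%N)).
- exact: (zP (Ordinal (isT : 1 < 4)%N)).
- exact: (zP (Ordinal (isT : 2 < 4)%N)).
- exact: (zP (Ordinal (isT : 3 < 4)%N)).
Qed.

(** Induction replaces the first two sets by their intersection; triples involving it meet by the
    four-set case. *)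
Lemma helly_plane (s : seq (set plane)) :
  {in s, forall A, convex_in A} ->
  {in s & & s, forall A B C, A `&` B `&` C !=set0} ->
  exists z, {in s, forall A, A z}.
Proof.
have [n] := ubnP (size s); elim: n s => // n IHn [|A [|B s]] /= lt_s cvx meet.
- by exists 0.
- have [z [[Az _] _]] := meet _ _ _ (mem_head _ _) (mem_head _ _) (mem_head _ _).
  by exists z => C; rewrite mem_seq1 => /eqP ->.
have sA : A \in A :: B :: s by rewrite mem_head.
have sB : B \in A :: B :: s by rewrite in_cons mem_head orbT.
have sS C : C \in s -> C \in A :: B :: s by rewrite !in_cons => ->; rewrite !orbT.
have meetAB C D : C \in s -> D \in s -> A `&` B `&` C `&` D !=set0.
  move=> /sS sC /sS sD; apply: helly4; by [exact: cvx|exact: meet].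
have [|||z zP] := IHn (A `&` B :: s).
- by [].
- move=> C; rewrite in_cons => /orP[/eqP->|/sS/cvx//] a b t [? ?] [? ?] ?.
  by split; [exact: (cvx _ sA)|exact: (cvx _ sB)].
- move=> C D E; rewrite !in_cons.
  case/orP=> [/eqP->|sC] /orP[/eqP->|sD] /orP[/eqP->|sE].
  + by have [z [[Az Bz] _]] := meet _ _ _ sA sB sB; exists z.
  + by have [z [[Az Bz] Ez]] := meet _ _ _ sA sB (sS _ sE); exists z.
  + by have [z [[Az Bz] Ez]] := meet _ _ _ sA sB (sS _ sD); exists z.
  + by have [z [[[Az Bz] Dz] Ez]] := meetAB _ _ sD sE; exists z.
  + by have [z [[Az Bz] Ez]] := meet _ _ _ sA sB (sS _ sC); exists z.
  + by have [z [[[Az Bz] Dz] Ez]] := meetAB _ _ sC sE; exists z.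
  + by have [z [[[Az Bz] Dz] Ez]] := meetAB _ _ sC sD; exists z.
  + exact: meet (sS _ sC) (sS _ sD) (sS _ sE).
exists z => C; rewrite in_cons => /orP[/eqP ->|].
  by have [] := zP _ (mem_head _ _).
rewrite in_cons => /orP[/eqP ->|sC]; first by have [] := zP _ (mem_head _ _).
by apply: zP; rewrite in_cons sC orbT.
Qed.

End Helly.

(** * Chords and regions *)

Section Regions.
Context {R : realType}.
Local Notation plane := (R * R)%type.
Implicit Types (z n : plane) (c t : R).

Definition affine_form n c z := z.1 * n.1 + z.2 * n.2 - c.

Lemma affine_form_line n c a b t :
  affine_form n c (a + t *: (b - a)) =
  (1 - t) * affine_form n c a + t * affine_form n c b.
Proof. by rewrite /affine_form /= /GRing.scale /=; ring. Qed.

Lemma affine_form_continuous n c : continuous (affine_form n c).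
Proof.
move=> z; apply: cvgB; last exact: cvg_cst.
apply: cvgD; apply: cvgMl; first exact: cvg_fst.
exact: cvg_snd.
Qed.

Lemma half_plane_convex n c : convex_in [set z | affine_form n c z <= 0].
Proof.
move=> a b t /= a0 b0 /andP[t0 t1]; rewrite affine_form_line.
by rewrite -[leRHS]addr0 lerD // mulr_ge0_le0 // subr_ge0.
Qed.

(* If [C] meets both half-planes only outside their intersection, then on a
   segment from one to the other the two forms vanish in the wrong order. *)
Lemma half_planes_connected n n' c c' (C : set plane) (H := fun b : bool =>
    [set z | affine_form (if b then n else n') (if b then c else c') z <= 0]) :
  convex_in C -> C `<=` H true `|` H false ->
  [\/ C `<=` H true, C `<=` H false | exists2 z, C z & H true z /\ H false z].
Proof.
move=> cvxC sub; have [|Ntrue] := pselect (C `<=` H true); first exact: Or31.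
have [|Nfalse] := pselect (C `<=` H false); first exact: Or32.
have [a [Ca Na]] : exists a, C a /\ ~ H true a.
  apply: contrapT => no; apply: Ntrue => a Ca; apply: contrapT => Na.
  by apply: no; exists a.
have [b [Cb Nb]] : exists b, C b /\ ~ H false b.
  apply: contrapT => no; apply: Nfalse => b Cb; apply: contrapT => Nb.
  by apply: no; exists b.
have b0 : affine_form n c b <= 0 by case: (sub b Cb).
have a0 : affine_form n' c' a <= 0 by case: (sub a Ca).
have a1 : 0 < affine_form n c a by rewrite ltNge; exact/negP.
have b1 : 0 < affine_form n' c' b by rewrite ltNge; exact/negP.
set la := affine_form n c a in a1; set lb := affine_form n c b in b0.
set ka := affine_form n' c' a in a0; set kb := affine_form n' c' b in b1.
pose t := la / (la - lb).
have lab : 0 < la - lb by lra.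
have t01 : 0 <= t <= 1.
  by rewrite /t divr_ge0 ?(ltW a1) ?(ltW lab) //= ler_pdivrMr //; lra.
pose s := ka / (ka - kb).
have kab : ka - kb < 0 by lra.
have s01 : 0 <= s <= 1.
  have -> : s = - ka / (kb - ka) by rewrite /s -opprB invrN mulrN mulNr.
  by rewrite divr_ge0 ?ler_pdivrMr //=; lra.
apply: Or33.
have lt_form u : affine_form n c (a + u *: (b - a)) = la - u * (la - lb).
  by rewrite affine_form_line -/la -/lb; ring.
have ls_form u : affine_form n' c' (a + u *: (b - a)) = ka - u * (ka - kb).
  by rewrite affine_form_line -/ka -/kb; ring.
have tE : t * (la - lb) = la by rewrite divfK ?gt_eqF.
have sE : s * (ka - kb) = ka by rewrite divfK ?lt_eqF.
(* The forms vanish at [t] and [s]. For [t <= s] the point at [t] is in both half-planes; otherwise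
   the midpoint parameter would give a point in neither. *)
have [le_ts|lt_st] := leP t s.
  exists (a + t *: (b - a)); first exact: cvxC.
  rewrite /H /= lt_form ls_form tE subrr; split=> //.
  by rewrite -{1}sE -mulrBl mulr_ge0_le0 ?subr_ge0 // ltW.
pose u := (s + t) / 2.
have u01 : 0 <= u <= 1 by rewrite /u; lra.
have : C (a + u *: (b - a)) by exact: cvxC.
move=> /sub[]; rewrite /H /= ?lt_form ?ls_form => le0; exfalso.
  have : (t - u) * (la - lb) <= 0 by rewrite mulrBl tE.
  by rewrite leNgt mulr_gt0 // /u; lra.
have : (s - u) * (ka - kb) <= 0 by rewrite mulrBl sE.
by rewrite leNgt nmulr_rgt0 // /u; lra.
Qed.

(** The unit vector to the middle of the arc from [a] to [b], that is, the circle point of parameter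
    [(a + b) / 2]. *)
Definition chord_normal (a b : R) : plane := (cos (pi * (a + b)), - sin (pi * (a + b))).

(* Vanishes on the chord through the points of parameters [a] and [b]. *)
Definition chord_form a b := affine_form (chord_normal a b) (cos (pi * (b - a))).

(** The complementary arc from [b] to [a + 1] has the antipodal midpoint, so the same chord gets the
    opposite orientation. *)
Lemma chord_form_shift a b z : chord_form b (a + 1) z = - chord_form a b z.
Proof.
rewrite /chord_form /affine_form /=.
have -> : pi * (b + (a + 1)) = pi * (a + b) + pi by ring.
have -> : pi * (a + 1 - b) = - (pi * (b - a)) + pi by ring.
by rewrite !cosDpi !sinDpi cosN; ring.
Qed.

(** On the circle the form is a difference of cosines; [t] is closer to the middle of the arc than
    its ends are, and cosine decreases on [[0, pi]]. *)
Lemma chord_form_arc a b t : a < t < b -> b <= a + 1 ->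
  0 < chord_form a b (circle_point t).
Proof.
move=> /andP[a_t tb] ba; rewrite /chord_form /affine_form /= mulrNN.
rewrite -cosB subr_gt0 -[X in _ < X]cos_norm.
have pi0 : 0 < pi :> R := pi_gt0 R.
have E : 2 * pi * t - pi * (a + b) = pi * (2 * t - a - b) by ring.
have [lo hi] : - (b - a) < 2 * t - a - b /\ 2 * t - a - b < b - a by split; lra.
have lt_n : `|2 * pi * t - pi * (a + b)| < pi * (b - a).
  by rewrite E normrM gtr0_norm // ltr_pM2l // ltr_norml lo hi.
have le_pi : pi * (b - a) <= pi by rewrite ler_piMr ?(ltW pi0) //; lra.
rewrite ltr_cos // in_itv /=; apply/andP; split=> //.
  exact: le_trans (ltW lt_n) le_pi.
exact: le_trans (normr_ge0 _) (ltW lt_n).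
Qed.

Lemma chord_form_segment a b z :
  segment (circle_point a) (circle_point b) z -> chord_form a b z = 0.
Proof.
move=> [t _ <-]; have end0 c : c = a \/ c = b -> chord_form a b (circle_point c) = 0.
  rewrite /chord_form /affine_form /= mulrNN -cosB => c_ab.
  apply/eqP; rewrite subr_eq0; apply/eqP; case: c_ab => ->.
    by rewrite -cosN; congr cos; ring.
  by congr cos; ring.
have -> : (1 - t) *: circle_point a + t *: circle_point b =
    circle_point a + t *: (circle_point b - circle_point a).
  by apply: plane_eq => /=; rewrite /GRing.scale /=; ring.
rewrite /chord_form affine_form_line -![affine_form _ _ _]/(chord_form a b _).
by rewrite !end0 ?mulr0 ?addr0 //; [right|left].
Qed.

(** With [d] half the central angle, the point has component [cos d] along the normal and [u] along
    the chord; the disk gives [|u| <= sin d], and the chord ends have [u = - sin d] and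
    [u = sin d]. *)
Lemma chord_form_eq0 a b z : a <= b -> b <= a + 1 -> closed_disk z ->
  chord_form a b z = 0 -> segment (circle_point a) (circle_point b) z.
Proof.
move=> ab ba; rewrite /closed_disk /chord_form /affine_form /circle_point /=.
set F := pi * (a + b); set d := pi * (b - a).
have -> : 2 * pi * a = F - d by rewrite /F /d; ring.
have -> : 2 * pi * b = F + d by rewrite /F /d; ring.
move=> disk /eqP; rewrite subr_eq0 mulrN => /eqP zd.
pose u := - (z.1 * sin F) - z.2 * cos F.
have CS := cos2Dsin2 F.
have z1 : z.1 = cos d * cos F - u * sin F.
  by rewrite -zd /u -[LHS]mulr1 -CS; ring.
have z2 : z.2 = - (cos d * sin F) - u * cos F.
  by rewrite -zd /u -[LHS]mulr1 -CS; ring.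
have le_u : u ^+ 2 <= sin d ^+ 2.
  have E : z.1 ^+ 2 + z.2 ^+ 2 = cos d ^+ 2 + u ^+ 2.
    rewrite -[RHS]mulr1 -CS {1}z1 {1}z2; ring.
  by rewrite sin2cos2; move: disk; rewrite E; lra.
have sd0 : 0 <= sin d.
  have pi0 : 0 < pi :> R := pi_gt0 R.
  apply: sin_ge0_pi; apply/andP; split; first by rewrite mulr_ge0 //; lra.
  by rewrite ler_piMr ?(ltW pi0) //; lra.
have [sd|sd] := eqVneq (sin d) 0.
  have u0 : u = 0.
    apply/eqP; rewrite -sqrf_eq0 eq_le sqr_ge0 andbT; move: le_u.
    by rewrite sd expr0n.
  exists 0; first by rewrite /= in_itv /= lexx ler01.
  apply: plane_eq => /=; rewrite /GRing.scale /= !(cosB, cosD, sinB, sinD) sd.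
    by rewrite z1 u0; ring.
  by rewrite z2 u0; ring.
have {sd}sd : 0 < sin d by rewrite lt0r sd.
have : `|u| <= sin d.
  by rewrite -(ger0_norm sd0) -ler_sqr ?nnegrE ?normr_ge0 // !real_normK ?num_real.
rewrite ler_norml => /andP[u1 u2].
exists ((u + sin d) / (2 * sin d)).
  rewrite /= in_itv /=; apply/andP; split; first by rewrite divr_ge0; lra.
  by rewrite ler_pdivrMr ?mulr_gt0 //; lra.
apply: plane_eq => /=; rewrite /GRing.scale /= !(cosB, cosD, sinB, sinD).
  by rewrite [RHS]z1; field; rewrite gt_eqF.
by rewrite [RHS]z2; field; rewrite gt_eqF.
Qed.

End Regions.

(** * Regions described by the signs of two affine forms *)

Section RegionHalfPlanes.
Context {R : realType}.
Local Notation plane := (R * R)%type.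
Implicit Types (x : 'rV[R]_4) (i : 'I_4) (z : plane).

Lemma psum_monotone x k l : simplex x -> (k <= l)%N -> psum x k <= psum x l.
Proof.
move=> [x0 _] kl; rewrite /psum big_mkcond [leRHS]big_mkcond.
apply: ler_sum => j _; case: ifP => [jk|_]; first by rewrite (leq_trans jk kl).
by case: ifP.
Qed.

Lemma psum0 x : psum x 0 = 0.
Proof. by rewrite /psum big_pred0. Qed.

Lemma psum4 x : simplex x -> psum x 4 = 1.
Proof. by move=> [_ <-]; apply: eq_bigl => j; rewrite ltn_ord. Qed.

Lemma circle_point0 : circle_point 0 = (1, 0) :> plane.
Proof. by rewrite /circle_point mulr0 cos0 sin0 oppr0. Qed.

(** Signs making both chord forms positive on the [i]-th arc: arcs 0 and 1 lie before [psum x 2],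
    arcs 1 and 2 between [psum x 1] and [psum x 3]. *)
Definition side02 i : R := if (i < 2)%N then 1 else -1.
Definition side13 i : R := if (0 < i < 3)%N then 1 else -1.

Definition form02 x i z := side02 i * chord_form 0 (psum x 2) z.
Definition form13 x i z := side13 i * chord_form (psum x 1) (psum x 3) z.

Lemma form02E x i : form02 x i =
  affine_form (side02 i *: chord_normal 0 (psum x 2))
    (side02 i * cos (pi * (psum x 2 - 0))).
Proof.
apply/funext => z; rewrite /form02 /chord_form /affine_form /= /GRing.scale /=.
ring.
Qed.

Lemma form13E x i : form13 x i =
  affine_form (side13 i *: chord_normal (psum x 1) (psum x 3))
    (side13 i * cos (pi * (psum x 3 - psum x 1))).
Proof.
apply/funext => z; rewrite /form13 /chord_form /affine_form /= /GRing.scale /=.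
ring.
Qed.

Lemma arc_forms_gt0 x i t : simplex x -> psum x i < t < psum x i.+1 ->
  0 < form02 x i (circle_point t) /\ 0 < form13 x i (circle_point t).
Proof.
move=> sx; have [s01 s12 s23 s34] : [/\ 0 <= psum x 1, psum x 1 <= psum x 2,
    psum x 2 <= psum x 3 & psum x 3 <= 1].
  by rewrite -(psum0 x) -(psum4 _ sx) !psum_monotone.
rewrite /form02 /form13 /side02 /side13.
case: i => [[|[|[|[|//]]]] ?] /=; rewrite ?psum0 ?(psum4 _ sx) => /andP[t0 t1].
- split; first by rewrite mul1r chord_form_arc //; lra.
  have -> : psum x 3 = (psum x 3 - 1) + 1 by ring.
  rewrite chord_form_shift mulN1r opprK chord_form_arc //; lra.
- by split; rewrite mul1r chord_form_arc //; lra.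
- split; last by rewrite mul1r chord_form_arc //; lra.
  rewrite mulN1r -chord_form_shift chord_form_arc //; lra.
- split; rewrite mulN1r -chord_form_shift chord_form_arc //; lra.
Qed.

Lemma forms_off_chords x i z : simplex x -> closed_disk z ->
  form02 x i z = 0 \/ form13 x i z = 0 -> (chord02 x `|` chord13 x) z.
Proof.
move=> sx dz; have [s01 s12 s23 s34] : [/\ 0 <= psum x 1, psum x 1 <= psum x 2,
    psum x 2 <= psum x 3 & psum x 3 <= 1].
  by rewrite -(psum0 x) -(psum4 _ sx) !psum_monotone.
have side0 (b : bool) (y : R) : (if b then 1 else -1) * y = 0 -> y = 0.
  by case: b; rewrite ?mul1r // mulN1r => /eqP; rewrite oppr_eq0 => /eqP.
move=> [/side0 z0|/side0 z0]; [left|right].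
  rewrite /chord02 -circle_point0; apply: chord_form_eq0 => //; lra.
by apply: chord_form_eq0 => //; lra.
Qed.

Lemma continuous_connected_gt0 (g : plane -> R) (K : set plane) a z :
  continuous g -> connected K -> (forall y, K y -> g y <> 0) ->
  K a -> 0 < g a -> K z -> 0 < g z.
Proof.
move=> cg cK g0 Ka ga Kz; rewrite ltNge; apply/negP => gz.
have : connected (g @` K).
  by apply: connected_continuous_connected => //; exact: continuous_subspaceT.
move/connected_intervalP => /(_ (g z) (g a)).
move=> /(_ (imageP _ Kz) (imageP _ Ka) 0); rewrite gz (ltW ga).
move=> /(_ isT)[y Ky gy0].
exact: g0 gy0.
Qed.

(** In the disk each form vanishes only on its chord, so a component off the chords keeps the
    positive sign found on the arc. *)
Lemma region_forms_gt0 x i z : simplex x -> region x i z ->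
  0 < form02 x i z /\ 0 < form13 x i z.
Proof.
move=> sx /interior_subset[t /= + Kz]; rewrite in_itv /= => /(arc_forms_gt0 _ _ _ sx)[].
move=> t02 t13.
set A := @closed_disk R `\` _ in Kz; set K := connected_component _ _ in Kz.
have At : A (circle_point t).
  by apply: contrapT => /connected_component_out NA; move: Kz; rewrite /K NA.
have Kt : K (circle_point t) by exact: connected_component_refl.
have cK : connected K by exact: component_connected.
have KA : K `<=` A by exact: connected_component_sub.
split; apply: (continuous_connected_gt0 _ K (circle_point t)) => //.
- by rewrite form02E; exact: affine_form_continuous.
- by move=> y /KA[dy Ny] y0; apply/Ny/(forms_off_chords _ i) => //; left.
- by rewrite form13E; exact: affine_form_continuous.
- by move=> y /KA[dy Ny] y0; apply/Ny/(forms_off_chords _ i) => //; right.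
Qed.

Lemma closed_disk_convex : convex_in (@closed_disk R).
Proof.
move=> a b t; rewrite /closed_disk /= /GRing.scale /= => a1 b1 /andP[t0 t1].
have tt : 0 <= t * (1 - t) by rewrite mulr_ge0 // subr_ge0.
have ab : 0 <= t * (1 - t) * ((a.1 - b.1) ^+ 2 + (a.2 - b.2) ^+ 2).
  by rewrite mulr_ge0 // addr_ge0 ?sqr_ge0.
have -> : (a.1 + t * (b.1 - a.1)) ^+ 2 + (a.2 + t * (b.2 - a.2)) ^+ 2 =
    (1 - t) * (a.1 ^+ 2 + a.2 ^+ 2) + t * (b.1 ^+ 2 + b.2 ^+ 2) -
    t * (1 - t) * ((a.1 - b.1) ^+ 2 + (a.2 - b.2) ^+ 2) by ring.
have : (1 - t) * (a.1 ^+ 2 + a.2 ^+ 2) <= (1 - t) * 1.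
  by rewrite ler_wpM2l // subr_ge0.
have : t * (b.1 ^+ 2 + b.2 ^+ 2) <= t * 1 by rewrite ler_wpM2l.
lra.
Qed.

(** The segment to a point of the arc keeps both forms positive, so it avoids the chords and stays
    in one component. The nonempty region supplies the arc parameter. *)
Lemma forms_gt0_region x i z : simplex x -> region x i !=set0 ->
  open_disk z -> 0 < form02 x i z -> 0 < form13 x i z -> region x i z.
Proof.
move=> sx [_ /interior_subset[t /= + _]]; rewrite in_itv /= => t_arc.
have [t02 t13] := arc_forms_gt0 _ _ _ sx t_arc.
pose W : set plane := [set z | z.1 ^+ 2 + z.2 ^+ 2 < 1] `&`
  ([set z | 0 < form02 x i z] `&` [set z | 0 < form13 x i z]).
have oW : open W.
  apply: openI; [|apply: openI].
  - apply: (@open_comp _ _ (fun z : plane => z.1 ^+ 2 + z.2 ^+ 2)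
      [set s : R | s < 1]); last exact: open_lt.
    move=> y _; apply: cvgD; rewrite expr2.
      by apply: cvgM; exact: cvg_fst.
    by apply: cvgM; exact: cvg_snd.
  - apply: (@open_comp _ _ (form02 x i) [set s : R | 0 < s]); last exact: open_gt.
    by move=> y _; rewrite form02E; exact: affine_form_continuous.
  - apply: (@open_comp _ _ (form13 x i) [set s : R | 0 < s]); last exact: open_gt.
    by move=> y _; rewrite form13E; exact: affine_form_continuous.
move=> dz z02 z13; have Wz : W z by [].
move: z {dz z02 z13} Wz; rewrite -[forall z, _]/(W `<=` region x i).
(* [W] is open, so inclusion in the union suffices for inclusion in its interior. *)
rewrite -open_subsetE // => z [dz [z02 z13]]; exists t.
  by rewrite /= in_itv.
have disk_t : closed_disk (circle_point t).
  by rewrite /closed_disk /= sqrrN cos2Dsin2.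
pose g s := circle_point t + s *: (z - circle_point t).
apply: (@connected_component_max _ _ (g @` `[0, 1])).
- by exists 0; rewrite /g ?scale0r ?addr0 //= in_itv /= lexx ler01.
- move=> _ [s /= + <-]; rewrite in_itv /= => s01; split.
    by apply: closed_disk_convex => //; exact: ltW.
  have /andP[s0 s1] := s01.
  have gt0 a b : 0 < a -> 0 < b -> 0 < (1 - s) * a + s * b :> R.
    move=> a0 b0; have [->|s_n0] := eqVneq s 0; first by rewrite subr0 mul1r mul0r addr0.
    by rewrite ltr_wpDl ?mulr_gt0 ?mulr_ge0 ?subr_ge0 ?(ltW a0) // lt0r s_n0.
  have g02 : 0 < form02 x i (g s).
    by rewrite form02E affine_form_line -form02E gt0.
  have g13 : 0 < form13 x i (g s).
    by rewrite form13E affine_form_line -form13E gt0.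
  rewrite /chord02 -circle_point0 => -[] /chord_form_segment gs0.
    by move: g02; rewrite /form02 gs0 mulr0 ltxx.
  by move: g13; rewrite /form13 gs0 mulr0 ltxx.
- apply: connected_continuous_connected; first exact: segment_connected.
  apply: continuous_subspaceT => s.
  by apply: cvgD; [exact: cvg_cst|apply: cvgZl; exact: cvg_id].
- exists 1; rewrite /g ?scale1r /= ?in_itv /= ?ler01 ?lexx //.
  by rewrite addrC subrK.
Qed.
End RegionHalfPlanes.

(** * The (4,3)-property *)

Lemma uniq4 {T : eqType} (a b c d : T) : a != b -> a != c -> a != d ->
  b != c -> b != d -> c != d -> uniq [:: a; b; c; d].
Proof.
by move=> ab ac ad bc bd cd; rewrite /= !inE !negb_or ab ac ad bc bd cd.
Qed.

Section FourThree.
Context {R : realType}.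
Local Notation plane := (R * R)%type.

Lemma card_set_seq {T : choiceType} (s : seq T) : uniq s -> [set` s] #= `I_(size s).
Proof.
move=> us; have -> : [set` s] = [set` [fset y in s]%fset].
  by apply/seteqP; split=> y /=; rewrite in_fset.
by apply/card_eq_fsetP; rewrite card_fseq undup_id.
Qed.

Lemma card_le_seq {T : choiceType} (A : set T) n (s : seq T) :
  `I_n #<= A -> A `<=` [set` s] -> (n <= size s)%N.
Proof.
move=> nA As; apply: leq_trans (size_undup s); rewrite -card_le_II.
rewrite -(card_le_eqr (card_set_seq (undup s) (undup_uniq s))).
apply: card_le_trans nA _; apply: subset_card_le => y /As /=.
by rewrite mem_undup.
Qed.

Variable F : set (set plane).
Hypothesis F43 : pq_property 4 3 F.

Lemma four_three (s : seq (set plane)) : uniq s -> size s = 4%N ->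
  (forall C, C \in s -> F C) -> exists z, (3 <= count (fun C => `[< C z >]) s)%N.
Proof.
move=> us s4 sF; have [||G [Gs G3 [z Gz]]] := F43 [set` s].
- by move=> C; exact: sF.
- by rewrite -s4; exact: card_set_seq.
exists z; rewrite -size_filter.
apply: (card_le_seq G); first by rewrite (card_le_eqr G3).
move=> C GC /=; rewrite mem_filter; apply/andP; split; last exact: Gs.
by apply/asboolP; exact: Gz.
Qed.

Hypothesis convexF : forall C, F C -> convex_in C.

(** Three distinct sets of [s] and [D] are four members; a common point of three of them is not in
    [D], so it lies in the other three, and Helly applies. *)
Lemma disjoint_member_common_point (D : set plane) (s : seq (set plane)) :
  uniq s -> (3 <= size s)%N -> (forall C, C \in s -> F C) -> F D ->
  D \notin s -> (forall C, C \in s -> C `&` D = set0) ->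
  exists z, {in s, forall C, C z}.
Proof.
move=> us s3 sF FD Ds CD0; apply: helly_plane => [C /sF|A B C sA sB sC].
  exact: convexF.
(* [A], [B], [C] may repeat: duplicates are removed and the list is completed from [s], so that its
   first three entries include them all. *)
pose t := undup [:: A; B; C].
have ts : {subset t <= s}.
  by move=> E; rewrite mem_undup !inE => /or3P[] /eqP ->.
pose t' := t ++ [seq E <- s | E \notin t].
have ut' : uniq t'.
  rewrite cat_uniq undup_uniq filter_uniq // andbT /= -all_predC.
  by apply/allP => E; rewrite mem_filter => /andP[].
have t's E : (E \in t') = (E \in s).
  rewrite mem_cat mem_filter; case: (boolP (E \in t)) => //= /ts ->.
  by [].
have t'3 : (3 <= size t')%N.
  by rewrite (perm_size (uniq_perm ut' us t's)).
have mem3 E : E \in take 3 t' -> E \in s by move/mem_take; rewrite t's.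
have tE E : E \in t -> E \in take 3 t'.
  have le3 : (size t <= 3)%N by exact: (size_undup [:: A; B; C]).
  by rewrite take_cat ltnNge le3 /= mem_cat => ->.
have [||| z] := four_three (D :: take 3 t').
- by rewrite /= take_uniq // andbT; apply: contra Ds => /mem3.
- by rewrite /= size_takel.
- by move=> E; rewrite in_cons => /orP[/eqP->//|/mem3/sF].
rewrite /= => cnt; have NDz : ~ D z.
  move=> Dz; move: cnt; have -> : count (fun E => `[< E z >]) (take 3 t') = 0%N.
    apply/eqP; rewrite -leqn0 leqNgt -has_count; apply/hasPn => E /mem3 sE.
    apply/asboolP => Ez; have : (E `&` D) z by [].
    by rewrite CD0.
  by case: asboolP.
move: cnt; rewrite asboolF //= add0n -{1}(size_takel t'3) => le_cnt.
have /allP all_z : all (fun E => `[< E z >]) (take 3 t').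
  by rewrite all_count eqn_leq count_size.
have tz E : E \in t -> E z by move=> /tE /all_z /asboolP.
by exists z; split; [split|]; apply: tz; rewrite mem_undup !inE eqxx ?orbT.
Qed.

End FourThree.

(** * Two points for the members missing a region *)

Section Piercing.
Context {R : realType}.
Local Notation plane := (R * R)%type.

Lemma piercing_number_le2 (G : set (set plane)) a b :
  (forall C, G C -> C a \/ C b) -> (piercing_number G <= 2%:E)%E.
Proof.
move=> ab; apply: (@le_trans _ _ (#|` [fset a; b]%fset|)%:R%:E).
  apply: ereal_inf_lbound; exists [fset a; b]%fset => //= C GC.
  by case: (ab C GC) => [Ca|Cb]; [exists a|exists b] => //; rewrite !inE eqxx ?orbT.
by rewrite lee_fin ler_nat cardfs2; case: eqVneq.
Qed.

(** Of the two unit vectors orthogonal to [n], one has a nonnegative product with [n']. *)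
Lemma unit_direction (n n' : plane) : n.1 ^+ 2 + n.2 ^+ 2 = 1 ->
  exists w : plane, [/\ w.1 ^+ 2 + w.2 ^+ 2 = 1,
    0 <= w.1 * n.1 + w.2 * n.2 & 0 <= w.1 * n'.1 + w.2 * n'.2].
Proof.
move=> n1; have [pos|neg] := leP 0 (- n.2 * n'.1 + n.1 * n'.2).
  by exists (- n.2, n.1); split=> //=; [rewrite sqrrN addrC|lra].
by exists (n.2, - n.1); split=> //=; [rewrite sqrrN addrC|lra|lra].
Qed.

Lemma side_normal_unit (b : bool) (a c : R) :
  let n := (if b then 1 else -1 : R) *: chord_normal a c in
  n.1 ^+ 2 + n.2 ^+ 2 = 1.
Proof.
rewrite /= /GRing.scale /= !exprMn sqrrN -mulrDr cos2Dsin2 mulr1.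
by case: b; rewrite ?sqrrN expr1n.
Qed.

Variable F : set (set plane).
Hypothesis finF : finite_set F.
Hypothesis cardF : `I_4 #<= F.
Hypothesis compactF : forall C, F C -> compact C.
Hypothesis convexF : forall C, F C -> convex_in C.
Hypothesis diskF : forall C, F C -> C `<=` @open_disk R.
Hypothesis F43 : pq_property 4 3 F.
Variable x : 'rV[R]_4.
Hypothesis xA : forall i : 'I_4, triple_set F i x.

Let sx : simplex x. Proof. by case: (xA ord0). Qed.

Lemma regions_disjoint z : region x (Ordinal (isT : 0 < 4)%N) z ->
  ~ region x (Ordinal (isT : 1 < 4)%N) z.
Proof.
move=> /(region_forms_gt0 _ _ _ sx)[_ z0] /(region_forms_gt0 _ _ _ sx)[_].
by move: z0; rewrite /form13 /side13 /= mulN1r mul1r; lra.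
Qed.

(** An empty member would miss all the others, which would then share a point. By the triples that
    point would lie in every region, but regions 0 and 1 are on opposite sides of a chord. *)
Lemma member_nonempty C : F C -> C !=set0.
Proof.
move=> FC; apply/set0P; apply: contraPneq FC => ->{C} F0.
have /finite_seqP[s sE] : finite_set (F `\ set0) by exact: finite_setD.
pose s' := undup s.
have s'E C : (C \in s') = `[< (F `\ set0) C >].
  by rewrite mem_undup; apply/idP/asboolP; rewrite sE.
have s'F C : C \in s' -> F C by rewrite s'E => /asboolP[].
have Fs' C : F C -> C !=set0 -> C \in s'.
  by move=> FC C0; rewrite s'E; apply/asboolP; split=> // e; move/set0P: C0; rewrite e eqxx.
have s3 : (3 <= size s')%N.
  rewrite -ltnS; apply: (card_le_seq _ _ (set0 :: s') cardF) => C FC /=.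
  rewrite in_cons; have [//|/set0P C0] := eqVneq C set0.
  exact: Fs'.
have [||z zP] := disjoint_member_common_point _ F43 convexF set0 s' (undup_uniq s) s3
  s'F F0.
- by rewrite s'E; apply/asboolP => -[_]; apply.
- by move=> C _; rewrite setI0.
have z_reg i : region x i z.
  have [_ [C1 [C2 [C3 [[F1 F2 F3] [[p [[C1p C2p] C3p]] [sub _ _]]]]]]] := xA i.
  by apply: sub; split; apply: zP; apply: Fs' => //; exists p.
exact: regions_disjoint (z_reg _) (z_reg _).
Qed.

Lemma avoiding_two_points i : exists a b, forall C, avoiding F x i C -> C a \/ C b.
Proof.
have finA : finite_set (avoiding F x i).
  by apply: sub_finite_set finF => C [].
have /finite_seqP[s0 s0E] := finA; pose s := undup s0.
have us : uniq s := undup_uniq s0.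
have sP C : C \in s -> F C /\ C `&` region x i = set0.
  rewrite mem_undup => sC; have : [set` s0] C by [].
  by rewrite -s0E => -[].
have sF C : C \in s -> F C by case/sP.
have s_reg C z : C \in s -> C z -> ~ region x i z.
  by move=> /sP[_ C0] Cz rz; have : (C `&` region x i) z by []; rewrite C0.
suff [a [b ab]] : exists a b, forall C, C \in s -> C a \/ C b.
  exists a, b => C AC; apply: ab; rewrite mem_undup.
  have : [set` s0] C by rewrite -s0E.
  by [].
have [s3|] := leqP 3 (size s); last first.
  case: s sF {us sP s_reg} => [|C [|C' [|//]]] sF _.
  - by exists 0, 0.
  - have [z Cz] := member_nonempty _ (sF _ (mem_head _ _)).
    by exists z, z => B; rewrite inE => /eqP ->; left.
  - have [z Cz] := member_nonempty _ (sF _ (mem_head _ _)).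
    have [|z' C'z'] := member_nonempty C'; first by apply: sF; rewrite !inE eqxx orbT.
    by exists z, z' => B; rewrite !inE => /orP[] /eqP ->; [left|right].
have [_ [D1 [D2 [D3 [[F1 F2 F3] [[p [[D1p D2p] D3p]] [D12 D13 D23]]]]]]] := xA i.
have reg_p : region x i p by exact: D12.
have degenerate D : F D -> D p -> D `<=` region x i ->
    exists a b, forall C, C \in s -> C a \/ C b.
  move=> FD Dp Dreg; have [||z zP] := disjoint_member_common_point _ F43 convexF D s us s3 sF FD.
  - by apply/negP => /s_reg/(_ Dp); apply.
  - move=> C sC; apply/seteqP; split=> // z [Cz /Dreg].
    exact: s_reg Cz.
  - by exists z, z => C /zP; left.
have [e12|/eqP N12] := pselect (D1 = D2).
  by apply: (degenerate D1) => // z D1z; apply: D12; rewrite -e12.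
have [e13|/eqP N13] := pselect (D1 = D3).
  by apply: (degenerate D1) => // z D1z; apply: D13; rewrite -e13.
have [e23|/eqP N23] := pselect (D2 = D3).
  by apply: (degenerate D2) => // z D2z; apply: D23; rewrite -e23.
pose D (j : 'I_3) := nth set0 [:: D1; D2; D3] j.
have DF j : F (D j) by case: j => [[|[|[|//]]] ?].
have Dp j : D j p by case: j => [[|[|[|//]]] ?].
have D_meet j k : j != k -> D j `&` D k `<=` region x i.
  by case: j k => [[|[|[|//]]] ?] [[|[|[|//]]] ?] //= _; rewrite setIC.
have D_neq j k : j != k -> D j != D k.
  by case: j k => [[|[|[|//]]] ?] [[|[|[|//]]] ?] //= _; rewrite eq_sym.
(* [D j] and [D k] meet only in the region, where [C] and [C'] have no point, so three of the four
   sharing a point must include [C] and [C']. *)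
have meet_pair C C' j k : C \in s -> C' \in s -> C != C' -> j != k ->
    exists2 l, l = j \/ l = k & C `&` C' `&` D l !=set0.
  move=> sC sC' CC' jk; have D_out l : D l \notin s.
    by apply/negP => /s_reg/(_ (Dp l)); apply.
  have [||| z /=] := four_three _ F43 [:: C; C'; D j; D k].
  - have neq E l : E \in s -> E != D l by move=> sE; apply: contraTneq sE => ->.
    by apply: uniq4 => //; by [exact: neq|exact: D_neq].
  - by [].
  - by move=> E; rewrite !inE => /or4P[] /eqP -> //; exact: sF.
  have NCreg : D j z /\ D k z -> ~ C z /\ ~ C' z.
    move=> /(D_meet _ _ jk) rz.
    by split=> Cz; [exact: (s_reg C z)|exact: (s_reg C' z)].
  case: (asboolP (C z)); case: (asboolP (C' z)); case: (asboolP (D j z));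
    case: (asboolP (D k z)) => //= Dkz Djz C'z Cz _.
  - by case: (NCreg (conj Djz Dkz)).
  - by exists j; [left|exists z].
  - by exists k; [right|exists z].
  - by case: (NCreg (conj Djz Dkz)).
  - by case: (NCreg (conj Djz Dkz)).
have meet_two C C' : C \in s -> C' \in s -> C != C' -> exists j k,
    [/\ j != k, C `&` C' `&` D j !=set0 & C `&` C' `&` D k !=set0].
  move=> sC sC' CC'; pose o j (lt_j : (j < 3)%N) := Ordinal lt_j.
  (* Indices 0 and 1 yield one index; the pair avoiding that index yields the second. *)
  have [j j01 Ij] := meet_pair C C' (o 0 isT) (o 1 isT) sC sC' CC' isT.
  case: j01 Ij => -> Ij.
    have [k k12 Ik] := meet_pair C C' (o 1 isT) (o 2 isT) sC sC' CC' isT.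
    by exists (o 0 isT), k; split=> //; case: k12 => ->.
  have [k k02 Ik] := meet_pair C C' (o 0 isT) (o 2 isT) sC sC' CC' isT.
  by exists (o 1 isT), k; split=> //; case: k02 => ->.
pose n := side02 i *: chord_normal 0 (psum x 2).
pose n' := side13 i *: chord_normal (psum x 1) (psum x 3).
pose c := side02 i * cos (pi * (psum x 2 - 0)).
pose c' := side13 i * cos (pi * (psum x 3 - psum x 1)).
(* Along [w] neither form decreases, so the ray from [p] stays in the region while it is in the
   disk. *)
have [w [w1 wn wn']] : exists w : plane, [/\ w.1 ^+ 2 + w.2 ^+ 2 = 1,
    0 <= w.1 * n.1 + w.2 * n.2 & 0 <= w.1 * n'.1 + w.2 * n'.2].
  by apply: unit_direction; exact: side_normal_unit.
have ray_gt0 m d t : 0 <= t -> 0 <= w.1 * m.1 + w.2 * m.2 ->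
    0 < affine_form m d p -> 0 < affine_form m d (p + t *: w).
  move=> t0 wm pm; have -> : affine_form m d (p + t *: w) =
      affine_form m d p + t * (w.1 * m.1 + w.2 * m.2).
    by rewrite /affine_form /= /GRing.scale /=; ring.
  by rewrite ltr_wpDr // mulr_ge0.
have [p02 p13] := region_forms_gt0 _ _ _ sx reg_p.
apply: (two_points_pierce p w (@open_disk R) (region x i) (fun b : bool =>
    [set z | affine_form (if b then n else n') (if b then c else c') z <= 0])
    D s w1).
- move=> t t0 disk_t; apply: forms_gt0_region => //; first by exists p.
    by rewrite form02E; apply: ray_gt0 => //; rewrite -form02E.
  by rewrite form13E; apply: ray_gt0 => //; rewrite -form13E.
- by move=> b; exact: half_plane_convex.
- move=> b z + rz; have [z02 z13] := region_forms_gt0 _ _ _ sx rz.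
  by case: b => /=; rewrite leNgt -?form02E -?form13E ?z02 ?z13.
- move=> z disk_z Nz; have [|z02] := leP (form02 x i z) 0.
    by rewrite form02E; left.
  have [|z13] := leP (form13 x i z) 0; first by rewrite form13E; right.
  by case: Nz; apply: forms_gt0_region => //; exists p.
- exact: half_planes_connected.
- exact: Dp.
- by move=> j; exact: convexF.
- by move=> j; exact: diskF.
- exact: D_meet.
- by move=> C /sF; exact: convexF.
- by move=> C /sF; exact: compactF.
- by move=> C /sF; exact: diskF.
- exact: s_reg.
move=> C C' sC sC'; have [<-|] := eqVneq C C'; last exact: meet_two.
(* For a set paired with itself, the points it shares with another set of [s] serve. *)
have [E sE CE] : exists2 E, E \in s & C != E.
  case: s us s3 {sC sC' sF sP s_reg degenerate meet_pair meet_two} => [|A [|B s]] //=.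
  rewrite inE negb_or => /andP[/andP[AB _] _] _.
  have [->|CA] := eqVneq C A; first by exists B; rewrite ?inE ?eqxx ?orbT.
  by exists A; rewrite ?inE ?eqxx.
have [j [k [jk [z [[Cz _] Dz]] [z' [[Cz' _] Dz']]]]] := meet_two C E sC sE CE.
by exists j, k; split=> //; [exists z|exists z'].
Qed.

End Piercing.

Theorem theorem6 (R : realType) (F : set (set (R * R)%type))
  (finF : finite_set F) (cardF : `I_4 #<= F)
  (compactF : forall C, F C -> compact C)
  (convexF : forall C, F C -> convex_set C)
  (diskF : forall C, F C -> C `<=` @open_disk R)
  (F43 : pq_property 4 3 F)
  (x : 'rV[R]_4) (xA : forall i : 'I_4, triple_set F i x) :
  forall i : 'I_4, (piercing_number (avoiding F x i) <= 2%:E)%E.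
Proof.
move=> i; have cvxF C : F C -> convex_in C by move=> /convexF; exact: convex_setP.
have [a [b ab]] := avoiding_two_points _ finF cardF compactF cvxF diskF F43 x xA i.
exact: piercing_number_le2 ab.
Qed.
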